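(* Let $f\in\mathbb{C}[x_0,\dots,x_n]_3$ be a homogeneous cubic, and let $X=V(f)\subset\mathbb{P}^n$. Then: (a) $\dim \mathrm{Irr}(f)+1\ge\dim\mathrm{Reg}(f)$. In particular, $\dim\mathrm{Reg}(f)=0$ whenever $f$ is smooth. (b) $\dim\mathrm{Irr}(f)=n-1$ if and only if $\mathrm{Irr}(f)$ is (set-theoretically) a hyperplane. In this case $X$ contains a double hyperplane and $\mathrm{Reg}(f)$ has either $0$, $1$, or $2$ closed points. (c) If $\dim\mathrm{Reg}(f)=n-1$, then $\dim\mathrm{Irr}(f)=n-2$.
   Context: For $f\in\mathbb{C}[x_0,\dots,x_n]_3$ put $q_i=\frac{\partial f}{\partial x_i}$. The eigenscheme $E(f)\subset\mathbb{P}^n$ is the closed subscheme defined by the $2\times2$ minors of the matrix with rows $(x_0,\dots,x_n)$ and $(q_0,\dots,q_n)$. The irregular eigenscheme $\mathrm{Irr}(f)\subset\mathbb{P}^n$ is the closed subscheme defined by the ideal $(q_0,\dots,q_n)$. The regular eigenscheme $\mathrm{Reg}(f)$ is the residue of $E(f)$ with respect to $\mathrm{Irr}(f)$, i.e. the closed subscheme of $\mathbb{P}^n$ defined by the saturation $\left(I(E(f)):I(\mathrm{Irr}(f))^{\infty}\right)$; it is the closure of the set of points $p\in E(f)$ at which not all $q_i$ vanish. The empty scheme has dimension $-1$. The cubic $f$ is smooth if the hypersurface $V(f)\subset\mathbb{P}^n$ is smooth. ''$X$ contains a double hyperplane'' means that $f$ is divisible by the square of a nonzero linear form.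
   Formalization: Part (c) is stated only for n ≥ 2: it fails for n = 1 (f = x_0^3 has Reg(f) and Irr(f) each a single point, so dim Irr(f) = 0, not −1) and for n = 0 (f = 0). *)

(* Defs.v *)
From HB Require Import structures.
From mathcomp Require Import all_boot all_order all_algebra.
From mathcomp Require Import boolp classical_sets functions cardinality reals.
From mathcomp Require Import complex mpoly.

Set Implicit Arguments.
Unset Strict Implicit.
Unset Printing Implicit Defensive.

Import Order.TTheory GRing.Theory Num.Theory.

Local Open Scope classical_set_scope.
Local Open Scope ring_scope.

(* Throughout, C is R[i] for a realType R, n is the dimension of P^n, and the  *)
(* homogeneous coordinates x_0, ..., x_n are indexed by 'I_n.+1.               *)

Section Ideals.
Variable A : comNzRingType.
Implicit Types S I J : set A.

Definition ideal_span S : set A :=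
  [set p | exists (m : nat) (c s : 'I_m -> A),
     (forall i, S (s i)) /\ p = \sum_(i < m) c i * s i].

Definition ideal_exp J (k : nat) : set A :=
  ideal_span [set \prod_(i < k) t i | t in [set t : 'I_k -> A | forall i, J (t i)]].

(* (I : J^oo), the union over k of the colon ideals (I : J^k) *)
Definition saturation I J : set A :=
  [set p | exists k : nat, forall h, ideal_exp J k h -> I (p * h)].

End Ideals.

Section ProjectiveSpace.
Variables (R : realType) (n : nat).

(* A (closed) point of P^n is a line through the origin in C^(n+1). *)
Definition proj_space :=
  {L : {vspace 'rV[R[i]]_n.+1} | \dim L == 1}.

Implicit Types (S I : set {mpoly R[i][n.+1]}) (Z : set proj_space).

(* Intended for sets S of forms and for homogeneous ideals S. *)
Definition zeros S : set proj_space :=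
  [set L : proj_space | forall g, S g -> forall x : 'rV[R[i]]_n.+1,
     x \in val L -> g.@[x ord0] = 0].

Definition zariski_closed Z : Prop :=
  exists S, (forall g, S g -> exists d : nat, g \is d.-homog) /\ Z = zeros S.

Definition zariski_irreducible Z : Prop :=
  Z !=set0 /\
  forall Z1 Z2, zariski_closed Z1 -> zariski_closed Z2 ->
    Z `<=` Z1 `|` Z2 -> Z `<=` Z1 \/ Z `<=` Z2.

(* Z contains a chain of m irreducible closed sets; such a chain has length    *)
(* m - 1, and the empty chain (m = 0) always exists.                           *)
Definition has_irr_chain Z (m : nat) : Prop :=
  exists F : 'I_m -> set proj_space,
    (forall i, [/\ zariski_closed (F i), zariski_irreducible (F i)
                 & F i `<=` Z]) /\
    (forall i j : 'I_m, (i < j)%N -> F i `<` F j).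

(* Krull dimension of a Zariski closed subset of P^n: the largest length of a  *)
(* chain of irreducible closed subsets, so that the empty set has dimension -1.*)
(* Chains in P^n have at most n + 1 members, so that the maximum exists and    *)
(* the default value of xget is never used.                                    *)
Definition proj_dim Z : int :=
  xget (-1) [set m%:Z - 1 | m in [set m : nat | has_irr_chain Z m /\
                forall k : nat, has_irr_chain Z k -> (k <= m)%N]].

Definition is_linear_form (l : {mpoly R[i][n.+1]}) : Prop :=
  l \is 1.-homog /\ l != 0.

Definition is_hyperplane Z : Prop :=
  exists2 l, is_linear_form l & Z = zeros [set l].

End ProjectiveSpace.

Section Eigenschemes.
Variables (R : realType) (n : nat) (f : {mpoly R[i][n.+1]}).

Definition irr_ideal : set {mpoly R[i][n.+1]} :=
  ideal_span (range (fun i : 'I_n.+1 => f^`M(i))).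

Definition eigen_mx : 'M[{mpoly R[i][n.+1]}]_(2, n.+1) :=
  \matrix_(k < 2, j < n.+1) if k == ord0 then 'X_j else f^`M(j).

(* Column selections g need not be increasing: the others only contribute 0    *)
(* and opposites of the usual minors.                                          *)
Definition eigen_ideal : set {mpoly R[i][n.+1]} :=
  ideal_span (range (fun g : 'I_2 -> 'I_n.+1 => \det (colsub g eigen_mx))).

Definition reg_ideal : set {mpoly R[i][n.+1]} :=
  saturation eigen_ideal irr_ideal.

(* Closed points of the closed subschemes of P^n defined by these ideals. *)
Definition Irr : set (proj_space R n) := zeros irr_ideal.
Definition Reg : set (proj_space R n) := zeros reg_ideal.

(* Smoothness of the hypersurface V(f), by the Jacobian criterion; it rules    *)
(* out f = 0.                                                                  *)
Definition smooth_form : Prop :=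
  forall L : proj_space R n, zeros [set f] L ->
    exists i : 'I_n.+1, ~ zeros [set f^`M(i)] L.

Definition contains_double_hyperplane : Prop :=
  exists2 l, is_linear_form l & exists g, f = l ^+ 2 * g.

End Eigenschemes.

(* Main.v *)
(* Let q = grad f.

   Dimension of a closed set is controlled through Hilbert functions: a chain of
   k+1 irreducible closed sets forces the forms of degree d on its top member to
   span a space of dimension at least c d^k, since a form vanishing on one member
   and not on the next is a nonzerodivisor; and m linear forms without common zero
   on a closed set bound that growth by c d^(m-1), by the Nullstellensatz.
   Conversely, a closed set without chain of length m+1 has m linear forms without
   common zero: choose each of them nonzero on every irreducible component.

   (a) An irreducible F in E(f) not contained in Irr(f) lifts to the variety
   q_i(x) = t x_i of P^(n+1). If l_1, ..., l_m have no common zero on Irr(f), then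
   t, l_1, ..., l_m have none on the lift. If f is smooth and there is no
   eigenvector, then (0 : 1) is the only point of q_i(x) = t x_i, and it is
   reduced, so that the residue ring has Hilbert function at most 1 in large
   degrees; but n+1 quadrics cut it down only to 2^(n+1) on average.

   (b) If dim Irr(f) = n-1, every line meets Irr(f), hence f has a double root on
   every line. Writing f(y + s x) as a cubic in s, the double root is a rational
   function V/Q with Q^3 = V^2 for a quadratic form Q, so that Q is the square of
   a linear form, the double root is linear in y, and f = l^2 g. With a = grad l
   and b = grad g, the points of Reg(f) lie on the line through a and b and are the
   zeros there of one binary quadratic form, nonzero unless Reg(f) is empty.

   (c) follows from (a) and (b). *)
Require Import Defs.
From HB Require Import structures.
From mathcomp Require Import all_boot all_order all_algebra.
From mathcomp Require Import boolp classical_sets functions cardinality reals.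
From mathcomp Require Import complex mpoly.
From mathcomp Require Import zify ring lra.

Set Implicit Arguments.
Unset Strict Implicit.
Unset Printing Implicit Defensive.

Import Order.TTheory GRing.Theory Num.Theory.

Local Open Scope classical_set_scope.
Local Open Scope card_scope.
Local Open Scope ring_scope.

(** * Ideals and the Hilbert basis theorem *)

Section IdealTheory.
Variable A : comNzRingType.
Implicit Types (S I J : set A) (a p q : A).

(** Hilbert functions are compared only along the multiples of one degree e: the forms that separate
    the members of a chain have uncontrolled degrees, and raising them to powers makes these degrees
    divisible by a common step. The summand 1 in (a) is the extra coordinate t. The minors defining
    E(f) are not a convenient set of equations; once the eigenvalue t is a coordinate they become
    q_i(x) = t x_i, and the section t = 0 of the lift lies over Irr(f). The obstacle in (b) is that
    points of Reg(f) may lie on Irr(f), where the eigen equations hold trivially. Since every q_i is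
    divisible by l, a factor l can be cancelled inside the saturation, and the equations so obtained
    hold at all points of Reg(f). The double root itself is first known only point by point; the
    identity Q^3 = V^2 is what makes it algebraic in y. The bound 2 <= n in (c) is essential: for n
    = 1 and f = x_0^2 x_1, Reg(f) is two points and Irr(f) is one, so that both have dimension 0 = n
    - 1. *)

Definition is_ideal I : Prop :=
  [/\ I 0, forall p q, I p -> I q -> I (p + q) & forall a p, I p -> I (a * p)].

Lemma is_ideal_sum I (T : Type) (r : seq T) (P : pred T) (F : T -> A) :
  is_ideal I -> (forall i, P i -> I (F i)) -> I (\sum_(i <- r | P i) F i).
Proof. by case=> I0 ID _ IF; apply: (big_ind I). Qed.

Lemma is_idealB I p q : is_ideal I -> I p -> I q -> I (p - q).
Proof. by case=> _ ID IM Ip Iq; apply: ID => //; rewrite -mulN1r; apply: IM. Qed.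

Lemma is_idealMr I p a : is_ideal I -> I p -> I (p * a).
Proof. by case=> _ _ IM Ip; rewrite mulrC; apply: IM. Qed.

Lemma ideal_span_min S I : is_ideal I -> S `<=` I -> ideal_span S `<=` I.
Proof.
move=> iI SI _ [m [c [s [Ss ->]]]]; apply: is_ideal_sum => // i _.
by case: iI => _ _; apply; apply: SI.
Qed.

Lemma sub_ideal_span S : S `<=` ideal_span S.
Proof.
by move=> p Sp; exists 1%N, (fun=> 1), (fun=> p); rewrite big_ord1 mul1r.
Qed.

Lemma ideal_span_ideal S : is_ideal (ideal_span S).
Proof.
split.
- by exists 0%N, (fun=> 0), (fun=> 0); split; [case | rewrite big_ord0].
- move=> _ _ [m1 [c1 [s1 [Ss1 ->]]]] [m2 [c2 [s2 [Ss2 ->]]]].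
  exists (m1 + m2)%N.
  exists (fun i : 'I_(m1 + m2) => match fintype.split i with inl j => c1 j | inr j => c2 j end).
  exists (fun i : 'I_(m1 + m2) => match fintype.split i with inl j => s1 j | inr j => s2 j end).
  split; first by move=> i; case: (fintype.split i).
  rewrite big_split_ord /=; congr (_ + _); apply: eq_bigr => i _.
    by rewrite (unsplitK (inl i)).
  by rewrite (unsplitK (inr i)).
- move=> a _ [m [c [s [Ss ->]]]]; exists m, (fun i => a * c i), s; split=> //.
  by rewrite big_distrr; apply: eq_bigr => i _; rewrite /= mulrA.
Qed.

Lemma ideal_spanS S J : S `<=` J -> ideal_span S `<=` ideal_span J.
Proof.
move=> SJ; apply: ideal_span_min; first exact: ideal_span_ideal.
by move=> p /SJ; apply: sub_ideal_span.
Qed.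

Lemma ideal_span_seqP (s : seq A) p : ideal_span [set` s] p ->
  exists c : 'I_(size s) -> A, p = \sum_(i < size s) c i * s`_i.
Proof.
apply: (@ideal_span_min _ [set p | exists c : 'I_(size s) -> A,
  p = \sum_(i < size s) c i * s`_i]); last first.
  move=> q /= qs; exists (fun i => if val i == index q s then 1 else 0).
  rewrite -index_mem in qs; rewrite (bigD1 (Ordinal qs)) //= eqxx mul1r.
  rewrite nth_index -?index_mem // big1 ?addr0 // => i.
  by rewrite -val_eqE /= => /negPf ->; rewrite mul0r.
split.
- by exists (fun=> 0); rewrite big1 // => i _; rewrite mul0r.
- move=> _ _ [c ->] [c' ->]; exists (fun i => c i + c' i).
  by rewrite -big_split; apply: eq_bigr => i _; rewrite /= mulrDl.
- move=> a _ [c ->]; exists (fun i => a * c i).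
  by rewrite big_distrr; apply: eq_bigr => i _; rewrite /= mulrA.
Qed.

Definition noetherian : Prop := forall I, is_ideal I ->
  exists s : seq A, [set` s] `<=` I /\ I `<=` ideal_span [set` s].

(** Without a maximal member, choice yields a strictly increasing sequence of ideals. The union is
    finitely generated, and its generators already lie in one term, which contradicts strictness. *)
Lemma noetherian_max (P : set (set A)) : noetherian -> P !=set0 ->
  P `<=` is_ideal -> exists2 M, P M & forall J, P J -> M `<=` J -> J `<=` M.
Proof.
move=> nA [I0 PI0] Pid; apply: contrapT => nmax.
have up (I : {I : set A | P I}) :
    {J : {J : set A | P J} | sval I `<=` sval J & ~ sval J `<=` sval I}.
  apply: cid2; case: I => I /= PI.
  apply: contrapT => nJ; apply: nmax; exists I => // J PJ IJ.
  by apply: contrapT => JI; apply: nJ; exists (exist _ J PJ).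
pose F k := iter k (fun I : {I : set A | P I} => s2val (up I)) (exist P I0 PI0).
pose G k := sval (F k).
have iG k : is_ideal (G k) by apply: Pid; apply: (svalP (F k)).
have GS k : G k `<=` G k.+1 by exact: (s2valP (up (F k))).
have Gn k : ~ G k.+1 `<=` G k by exact: (s2valP' (up (F k))).
have Gle i j : (i <= j)%N -> G i `<=` G j.
  move=> /subnK <-; elim: (j - i)%N => [|k IH] //.
  by apply: subset_trans IH _; rewrite addSn; apply: GS.
have iU : is_ideal (\bigcup_k G k).
  split; first by exists 0%N => //; case: (iG 0%N).
  - move=> p q [i _ Gp] [j _ Gq]; exists (maxn i j) => //.
    have [_ GD _] := iG (maxn i j); apply: GD.
      exact: Gle (leq_maxl _ _) _ Gp.
    exact: Gle (leq_maxr _ _) _ Gq.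
  - by move=> a p [i _ Gp]; exists i => //; case: (iG i) => _ _; apply.
have [s [sU Us]] := nA _ iU.
have [k sk] : exists k, [set` s] `<=` G k.
  elim: s sU {Us} => [|p s IH] sU; first by exists 0%N.
  have [|k sk] := IH; first by move=> q /= qs; apply: sU; rewrite /= inE qs orbT.
  have [|i _ Gp] := sU p; first by rewrite /= mem_head.
  exists (maxn i k) => q /=; rewrite inE => /orP[/eqP -> | /sk Gq].
    exact: Gle (leq_maxl _ _) _ Gp.
  exact: Gle (leq_maxr _ _) _ Gq.
apply: (Gn k) => p Gp; apply: (ideal_span_min (iG k) sk); apply: Us.
by exists k.+1.
Qed.

End IdealTheory.

Lemma noetherian_surj (A B : comNzRingType) (h : {rmorphism A -> B}) :
  (forall b, exists a, h a = b) -> noetherian A -> noetherian B.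
Proof.
move=> hsurj nA I iI; have [I0 ID IM] := iI.
have [|s [sI Is]] := nA [set a | I (h a)].
  split=> [|p q|a p] /=; first by rewrite rmorph0.
    by rewrite rmorphD; apply: ID.
  by rewrite rmorphM; apply: IM.
exists (map h s); split=> [_ /mapP[a /sI Ia ->] //|b Ib].
have [a hab] := hsurj b.
have /ideal_span_seqP[c ac] : ideal_span [set` s] a.
  by apply: Is; rewrite /= hab.
rewrite -hab ac rmorph_sum; apply: is_ideal_sum => [|i _].
  exact: ideal_span_ideal.
rewrite rmorphM; case: (ideal_span_ideal [set` map h s]) => _ _; apply.
by apply: sub_ideal_span; apply: map_f; apply: mem_nth.
Qed.

(** Hilbert's argument: the ideals [L d] of coefficients of X^d of members of [I] of degree at most
    d increase with d and are stationary from some [D] on. Lifts of generators of [L 0], ..., [L D]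
    generate [I], by descent on the degree. *)
Lemma noetherian_poly (A : comNzRingType) : noetherian A -> noetherian {poly A}.
Proof.
move=> nA I iI; have [I0 ID IM] := iI.
pose L d := [set a | exists p : {poly A}, [/\ I p, (size p <= d.+1)%N & p`_d = a]].
have iL d : is_ideal (L d).
  split; first by exists 0; rewrite size_poly0 coef0.
  - move=> _ _ [p [Ip sp <-]] [q [Iq sq <-]]; exists (p + q).
    rewrite coefD; split=> //; first exact: ID.
    by apply: leq_trans (size_polyD _ _) _; rewrite geq_max sp.
  - move=> a _ [p [Ip sp <-]]; exists (a%:P * p).
    rewrite coefCM mul_polyC (leq_trans (size_scale_leq _ _)) //.
    by split=> //; rewrite -mul_polyC; apply: IM.
have LS d e : (d <= e)%N -> L d `<=` L e.
  move=> /subnK <-; elim: (e - d)%N => [|k IH] // _ /IH [p [Ip sp <-]].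
  exists ('X * p); rewrite -commr_polyX coefMX /=; split=> //.
    exact: is_idealMr.
  by apply: leq_trans (size_polyMleq _ _) _; rewrite size_polyX addn2.
have [|_ [D _ <-] LD] := @noetherian_max _ (range L) nA (ex_intro _ _ (imageT L 0%N)).
  by move=> _ [d _ <-].
have {}LD d : L d `<=` L (minn d D).
  have [dD|/ltnW Dd] := leqP d D => //.
  by apply: LD; [exists d | apply: LS].
have ht d : exists t : seq {poly A}, [/\ [set` t] `<=` I & L d `<=`
    [set a | exists q, [/\ ideal_span [set` t] q, (size q <= d.+1)%N & q`_d = a]]].
  have [s [sL Ls]] := nA _ (iL d).
  suff [t [tI st]] : exists t : seq {poly A}, [set` t] `<=` I /\
     forall a, a \in s -> exists q, [/\ q \in t, (size q <= d.+1)%N & q`_d = a].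
    have [T0 TD TM] := ideal_span_ideal [set` t].
    exists t; split=> //; apply: subset_trans Ls _; apply: ideal_span_min.
      split; first by exists 0; rewrite size_poly0 coef0.
      - move=> _ _ [p [Ip sp <-]] [q [Iq sq <-]]; exists (p + q).
        rewrite coefD; split=> //; first exact: TD.
        by apply: leq_trans (size_polyD _ _) _; rewrite geq_max sp.
      - move=> a _ [p [Ip sp <-]]; exists (a%:P * p).
        rewrite coefCM mul_polyC (leq_trans (size_scale_leq _ _)) //.
        by split=> //; rewrite -mul_polyC; apply: TM.
    move=> a /= /st[q [qt sq <-]]; exists q; split=> //.
    exact: sub_ideal_span.
  elim: s sL {Ls} => [|a s IH] sL; first by exists [::].
  have [|t [tI st]] := IH.
    by move=> q /= qs; apply: sL; rewrite /= inE qs orbT.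
  have [|p [Ip sp pa]] := sL a; first by rewrite /= mem_head.
  exists (p :: t); split=> [q /=|b].
    by rewrite inE => /orP[/eqP -> | /tI].
  rewrite !inE => /orP[/eqP -> | /st[q [qt sq <-]]].
    by exists p; rewrite mem_head.
  by exists q; rewrite inE qt orbT.
have {ht} [t ht] := choice ht.
pose s := flatten [seq t d | d <- iota 0 D.+1].
have ts d : (d <= D)%N -> [set` t d] `<=` [set` s].
  move=> dD q /= qt; apply/flattenP; exists (t d) => //.
  by apply: map_f; rewrite mem_iota.
exists s; split=> [q /= /flattenP[_ /mapP[d _ ->]]|p Ip].
  by case: (ht d) => tI _; apply: tI.
have [S0 SD SM] := ideal_span_ideal [set` s].
have sI : ideal_span [set` s] `<=` I.
  apply: ideal_span_min => // q /= /flattenP[_ /mapP[d _ ->]].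
  by case: (ht d) => tI _; apply: tI.
have [m] := ubnP (size p); elim: m p Ip => // m IH p Ip; rewrite ltnS => sp.
case: m => [|m] in IH sp *.
  by move: sp; rewrite leqn0 size_poly_eq0 => /eqP ->.
have /LD Lpm : L m p`_m by exists p.
have [_ /(_ _ Lpm) [q [tq sq qm]]] := ht (minn m D).
have {}tq : ideal_span [set` s] q.
  by apply: ideal_spanS tq; apply: ts; apply: geq_minr.
(* Shifting [q] from degree [minn m D] to degree [m] gives it the same coefficient there as [p], so
   that [p - r] has smaller size. *)
pose r := 'X^(m - minn m D) * q.
have Sr : ideal_span [set` s] r by apply: SM.
rewrite -(subrK r p); apply: SD => //; apply: IH; first by apply: is_idealB => //; apply: sI.
apply/leq_sizeP => j; rewrite leq_eqVlt coefB => /orP[/eqP <- | mj].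
  rewrite /r mulrC coefMXn ltnNge leq_subr /= subKn ?geq_minl // qm subrr.
  by [].
rewrite nth_default ?(leq_trans sp) // sub0r /r mulrC coefMXn.
rewrite [q`__]nth_default ?if_same ?oppr0 //.
by apply: leq_trans sq _; have := geq_minl m D; lia.
Qed.

(** Presents the polynomials in n + 1 variables as a quotient of univariate polynomials over those
    in n variables; this drives inductions on the number of variables. *)
Lemma mpoly_horner (K : fieldType) (n : nat) (p : {mpoly K[n.+1]}) :
  exists q : {poly {mpoly K[n]}}, p = (map_poly (@mwiden n K) q).['X_ord_max].
Proof.
have cx : commr_rmorph (@mwiden n K) ('X_ord_max : {mpoly K[n.+1]}).
  by move=> x; apply: mulrC.
suff [q <-] : exists q, horner_morph cx q = p by exists q.
have hX i : exists a, horner_morph cx a = 'X_i.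
  case: (unliftP ord_max i) => [j ->|->].
    exists ('X_j)%:P; rewrite horner_morphC /= mwidenX mnmwiden1.
    congr (mpolyX _ (mnm1 _)); apply/val_inj => /=.
    by rewrite /bump leqNgt ltn_ord.
  by exists 'X; rewrite horner_morphX.
elim/mpolyind: p => [|c m p _ _ [q <-]]; first by exists 0; rewrite rmorph0.
pose im p := exists a, horner_morph cx a = p.
suff [a ha] : im 'X_[m].
  exists ((c%:MP)%:P * a + q).
  by rewrite rmorphD rmorphM /= horner_morphC /= mwidenC mul_mpolyC ha.
rewrite mpolyXE_id; apply: (big_ind im).
- by exists 1; rewrite rmorph1.
- by move=> _ _ [a <-] [b <-]; exists (a * b); rewrite rmorphM.
- by move=> i _; have [a <-] := hX i; exists (a ^+ m i); rewrite rmorphXn.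
Qed.

Lemma noetherian_mpoly (K : fieldType) (n : nat) : noetherian {mpoly K[n]}.
Proof.
elim: n => [|n IH].
  move=> I [I0 ID IM]; have [[p Ip pn0]|nI] := pselect (exists2 p, I p & p != 0).
    exists [:: p]; split=> [q /=|q _]; first by rewrite inE => /eqP ->.
    rewrite (_ : q = q * (p@_0)^-1%:MP * p).
      case: (ideal_span_ideal [set` [:: p]]) => _ _; apply.
      by apply: sub_ideal_span; rewrite /= mem_head.
    rewrite -mulrA {2}(nvar0_mpolyC p) -mpolyCM mulVf ?mulr1 //.
    by apply: contraNneq pn0 => p0; rewrite (nvar0_mpolyC p) p0.
  exists [::]; split=> // q Iq; have [->|qn0] := eqVneq q 0.
    by case: (ideal_span_ideal [set` ([::] : seq {mpoly K[0]})]).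
  by case: nI; exists q.
have cx : commr_rmorph (@mwiden n K) ('X_ord_max : {mpoly K[n.+1]}).
  by move=> x; apply: mulrC.
apply: (@noetherian_surj _ _ (horner_morph cx)); last exact: noetherian_poly.
by move=> p; have [q ->] := mpoly_horner p; exists q.
Qed.

(** * Nullstellensatz *)

(** Nested intervals [a k, a k + e k] of length 3^-k: the next one is the left or the right third,
    on the side of the midpoint away from [f k]. The supremum of the left ends lies in all of
    them. *)
Lemma real_not_enumerable (R : realType) (f : nat -> R) :
  exists x : R, forall k : nat, f k <> x.
Proof.
pose e k : R := 3^-1 ^+ k.
have e0 k : 0 < e k by rewrite exprn_gt0 // invr_gt0.
have eS k : e k = 3 * e k.+1 by rewrite /e exprS; field.
pose a := fix a (k : nat) : R := if k is j.+1 then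
  (if f j < a j + 3 / 2 * e j.+1 then a j + 2 * e j.+1 else a j) else 0.
have aS k : a k <= a k.+1.
  by move=> /=; case: ifP => _ //; have := e0 k.+1; lra.
have bS k : a k.+1 + e k.+1 <= a k + e k.
  by move=> /=; case: ifP => _; rewrite (eS k); have := e0 k.+1; lra.
have ale i j : (i <= j)%N -> a i <= a j.
  move=> /subnK <-; elim: (j - i)%N => [|k IH] //.
  by apply: le_trans IH _; rewrite addSn; apply: aS.
have ble i j : (i <= j)%N -> a j + e j <= a i + e i.
  move=> /subnK <-; elim: (j - i)%N => [|k IH] //.
  by apply: le_trans IH; rewrite addSn; apply: bS.
have ab i j : a i <= a j + e j.
  have [/ale aij|/ltnW/ble bij] := leqP i j; first by have := e0 j; lra.
  by have := e0 i; lra.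
have suA : has_sup (range a).
  split; first by exists (a 0%N), 0%N.
  by exists (a 0%N + e 0%N) => _ [i _ <-]; apply: ab.
exists (sup (range a)) => k fk.
have lo : a k.+1 <= f k.
  by rewrite fk; apply: ub_le_sup; [exact: suA.2 | exists k.+1].
have hi : f k <= a k.+1 + e k.+1.
  rewrite fk; apply: ge_sup; first exact: suA.1.
  by move=> _ [i _ <-]; apply: ab.
move: lo hi => /=; case: ltP => ? ? ?; have := e0 k.+1; lra.
Qed.

(** Some label is taken infinitely often already on the real line; otherwise the reals would be a
    countable union of finite sets. *)
Lemma uncountable_fiber (R : realType) (nu : R[i] -> nat) :
  exists k, forall D, exists c : 'I_D -> R[i], injective c /\ forall i, nu (c i) = k.
Proof.
pose A k := [set x : R | nu (real_complex R x) = k].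
have [[k Ainf]|fin] := pselect (exists k, infinite_set (A k)).
  exists k => D; have [B BA Dle] := infinite_set_fset D Ainf.
  have Bi (i : 'I_D) : (i < size (finmap.enum_fset B))%N by apply: leq_trans Dle.
  exists (fun i : 'I_D => real_complex R (nth 0 (finmap.enum_fset B) i)); split=> [i j [/eqP]|i].
    by rewrite nth_uniq ?finmap.fset_uniq ?Bi // => /eqP/val_inj.
  by apply: (BA (nth 0 (finmap.enum_fset B) i)); apply: mem_nth.
have /countable_injP[g ginj] : countable [set: R].
  rewrite (_ : setT = \bigcup_k A k).
    apply: bigcup_countable => // k _; apply: finite_set_countable.
    by apply: contrapT => Ainf; apply: fin; exists k.
  by apply/esym/seteqP; split=> // x _; exists (nu (real_complex R x)).
pose f k := xget (0 : R) [set x | g x = k].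
have [x fx] := real_not_enumerable f; case: (fx (g x)).
apply: ginj; rewrite ?inE //.
by rewrite /f; case: xgetP => [y _ /= -> | /(_ x)/(_ erefl)].
Qed.

Lemma left_kernel_exists (K : fieldType) (m p : nat) (M : 'M[K]_(m, p)) :
  (p < m)%N -> exists2 v : 'rV_m, v != 0 & v *m M = 0.
Proof.
move=> pm; exists (nz_row (kermx M)).
  rewrite nz_row_eq0 -mxrank_eq0 mxrank_ker subn_eq0 -ltnNge.
  exact: leq_ltn_trans (rank_leq_col M) pm.
by apply/sub_kermxP; apply: nz_row_sub.
Qed.

Lemma mpoly_dep (K : fieldType) (n s : nat) :
  exists D, forall u : 'I_D -> {mpoly K[n]}, (forall i, msize (u i) <= s)%N ->
  exists2 c : 'I_D -> K, exists i, c i != 0 & \sum_i c i *: u i = 0.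
Proof.
exists #|{: 'X_{1..n < s}}|.+1 => u us.
pose M := \matrix_(i < #|{: 'X_{1..n < s}}|.+1, j < #|{: 'X_{1..n < s}}|) (u i)@_(bmnm (enum_val j)).
have [v v0 vM] := left_kernel_exists M (ltnSn _).
exists (v ord0).
  by have /rV0Pn[j vj] := v0; exists j.
apply/mpolyP => m; rewrite raddf_sum mcoeff0 /=.
have [ms|sm] := ltnP (mdeg m) s; last first.
  apply: big1 => i _; rewrite mcoeffZ memN_msupp_eq0 ?mulr0 //.
  by apply: msize_mdeg_ge; apply: leq_trans (us i) sm.
have /rowP/(_ (enum_rank (BMultinom ms))) := vM.
rewrite !mxE => S0; rewrite -[RHS]S0; apply: eq_bigr => i _.
by rewrite mcoeffZ mxE enum_rankK.
Qed.

(** Think of [u j] as w / h_j modulo an ideal: the linear relation then reads as the vanishing of a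
    sum of partial fractions, and this is the identity after clearing denominators. *)
Lemma sum_prod_others (K : fieldType) (n D : nat) (w : {mpoly K[n]})
    (h u : 'I_D -> {mpoly K[n]}) (la : 'I_D -> K) : \sum_j la j *: u j = 0 ->
  w * (\sum_j la j *: \prod_(l | l != j) h l) =
  \sum_j (la j *: \prod_(l | l != j) h l) * (w - h j * u j).
Proof.
move=> lau; rewrite -[LHS]subr0 -[X in _ - X = _](mulr0 (\prod_l h l)).
rewrite -[X in _ - _ * X = _]lau !mulr_sumr -sumrB; apply: eq_bigr => j _.
have -> : \prod_l h l = h j * \prod_(l | l != j) h l by rewrite (bigD1 j).
move: (\prod_(l | l != j) h l) => Q.
by rewrite -!mul_mpolyC; ring.
Qed.

Section Nullstellensatz.
Variables (R : realType) (n : nat).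
Local Notation T := {mpoly R[i][n]}.
Variables (g : T) (M : set T).
Hypotheses (M_ideal : is_ideal M) (M_avoid : forall k, ~ M (g ^+ k)).
Hypothesis M_max : forall J : set T, is_ideal J -> (forall k, ~ J (g ^+ k)) ->
  M `<=` J -> J `<=` M.

(** By maximality M + (a) contains a power of [g]. Thus an element outside [M] becomes invertible
    modulo [M] once [g] is inverted. *)
Lemma max_avoid_add a : ~ M a -> exists k u, M (g ^+ k - a * u).
Proof.
move=> Ma; apply: contrapT => nku; apply: Ma.
have [M0 MD MM] := M_ideal.
apply: (M_max (J := [set p | exists u, M (p - a * u)])).
- split; first by exists 0; rewrite mulr0 subr0.
  + move=> p q [u Mu] [v Mv]; exists (u + v).
    by rewrite mulrDr opprD addrACA; apply: (MD).
  + move=> b p [u Mu]; exists (b * u).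
    by rewrite mulrCA -mulrBr; apply: (MM).
- by move=> k [u Mu]; apply: nku; exists k, u.
- by move=> p Mp; exists 0; rewrite mulr0 subr0.
- by exists 1; rewrite mulr1 subrr.
Qed.

Lemma max_avoid_prime a b : M (a * b) -> M a \/ M b.
Proof.
move=> Mab; have [M0 MD MM] := M_ideal.
have [Ma|/max_avoid_add[k [u Mu]]] := pselect (M a); first by left.
have [Mb|/max_avoid_add[l [v Mv]]] := pselect (M b); first by right.
case: (@M_avoid (k + l)%N); rewrite exprD.
rewrite (_ : _ * _ = g ^+ l * (g ^+ k - a * u) + a * u * (g ^+ l - b * v)
                     + u * v * (a * b)); last by ring.
by apply: (MD); [apply: (MD)|]; apply: (MM).
Qed.

Lemma max_avoid_prod (I : eqType) (r : seq I) (F : I -> T) :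
  M (\prod_(i <- r) F i) -> exists i, M (F i).
Proof.
elim: r => [|i r IH]; last first.
  by rewrite big_cons => /max_avoid_prime[|/IH //]; exists i.
by rewrite big_nil -(expr0 g) => /M_avoid.
Qed.

(** If no X_i - c is in [M], each has an inverse up to a power of [g]. By uncountability,
    arbitrarily many c share the exponent and the degree of the inverse, so these inverses become
    linearly dependent. Clearing denominators yields a nonzero univariate [r] with g^k r(X_i) in
    [M]; as [r] splits and [M] is prime, a linear factor lies in [M] after all. *)
Lemma max_avoid_coord (i : 'I_n) : exists c, M ('X_i - c%:MP).
Proof.
apply: contrapT => nc; have [M0 MD MM] := M_ideal.
have ku c : {ku : nat * T | M (g ^+ ku.1 - ('X_i - c%:MP) * ku.2)}.
  apply: cid; have [|k [u Mku]] := @max_avoid_add ('X_i - c%:MP).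
    by move=> Mc; apply: nc; exists c.
  by exists (k, u).
have [N hN] := uncountable_fiber (fun c => pickle ((sval (ku c)).1, msize (sval (ku c)).2)).
have [c0 [_ c0N]] := hN 1%N.
pose k := (sval (ku (c0 ord0))).1; pose s := msize (sval (ku (c0 ord0))).2.
have [D hD] := mpoly_dep R[i] n s.
have [c [cinj cN]] := hN D.
have ck j : (sval (ku (c j))).1 = k /\ msize (sval (ku (c j))).2 = s.
  by have /(pcan_inj pickleK)[-> ->] := etrans (cN j) (esym (c0N ord0)).
pose u j := (sval (ku (c j))).2.
have Mu j : M (g ^+ k - ('X_i - (c j)%:MP) * u j).
  by rewrite -(ck j).1; apply: (svalP (ku (c j))).
have [|la [j0 laj0] lau] := hD u; first by move=> j; rewrite (ck j).2.
pose r : {poly R[i]} := \sum_j la j *: \prod_(l | l != j) ('X - (c l)%:P).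
(* At [c j0] only the summand of index [j0] survives, because the [c j] are distinct. *)
have r0 : r.[c j0] != 0.
  rewrite horner_sum (bigD1 j0) //= [X in _ + X]big1 ?addr0 => [|j jj0].
    rewrite hornerZ horner_prod mulf_neq0 // prodf_seq_neq0.
    apply/allP => l _; apply/implyP => lj; rewrite !hornerE subr_eq0.
    by rewrite (inj_eq cinj) eq_sym.
  rewrite eq_sym in jj0; rewrite hornerZ horner_prod (bigD1 j0) //=.
  by rewrite hornerXsubC subrr mul0r mulr0.
pose ev (p : {poly R[i]}) : T := (map_poly (@mpolyC n R[i]) p).['X_i].
have Mr : M (g ^+ k * ev r).
  have -> : ev r = \sum_j la j *: \prod_(l | l != j) ('X_i - (c l)%:MP).
    rewrite /ev /r rmorph_sum horner_sum; apply: eq_bigr => j _ /=.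
    rewrite map_polyZ hornerZ mul_mpolyC; congr (_ *: _).
    rewrite rmorph_prod horner_prod; apply: eq_bigr => l _ /=.
    by rewrite map_polyXsubC !hornerE.
  rewrite (sum_prod_others (g ^+ k) (fun l => 'X_i - (c l)%:MP) lau).
  by apply: is_ideal_sum => // j _; apply: (MM).
have [] := max_avoid_prime Mr; first exact: M_avoid.
have [sr r_split] := closed_field_poly_normal r.
rewrite r_split /ev map_polyZ hornerZ => /max_avoid_prime[Mlc|].
  case: (@M_avoid 0%N); rewrite expr0.
  rewrite -[1]mulr1 -[X in X * _](_ : (lead_coef r)^-1%:MP * (lead_coef r)%:MP = _).
    by rewrite mulr1; apply: (MM).
  rewrite -mpolyCM mulVf // lead_coef_eq0.
  by apply: contraNneq r0 => ->; rewrite horner0.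
rewrite rmorph_prod horner_prod => /max_avoid_prod[z] /=.
by rewrite map_polyXsubC !hornerE => Mz; apply: nc; exists z.
Qed.

(** With v the vector of the constants found for the coordinates, every p is congruent to p(v)
    modulo [M]; a nonzero value p(v) of a member of [M] would put 1 = g^0 in [M]. *)
Lemma max_avoid_point :
  exists v : 'I_n -> R[i], g.@[v] != 0 /\ forall p, M p -> p.@[v] = 0.
Proof.
have [M0 MD MM] := M_ideal.
have [v Mv] := choice max_avoid_coord.
have Mev p : M (p - p.@[v]%:MP).
  elim/mpolyind: p => [|c m p _ _ IH]; first by rewrite meval0 subrr.
  rewrite mevalD mpolyCD opprD addrACA; apply: (MD) => //.
  rewrite mevalZ mpolyCM mul_mpolyC -scalerBr -mul_mpolyC; apply: (MM).
  rewrite mevalX mpolyXE_id.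
  have MX (q1 q2 : T) a b : M (q1 - a%:MP) -> M (q2 - b%:MP) ->
      M (q1 * q2 - (a * b)%:MP).
    move=> Mq1 Mq2; rewrite mpolyCM (_ : _ - _ =
      q2 * (q1 - a%:MP) + a%:MP * (q2 - b%:MP)); last by ring.
    by apply: (MD); apply: (MM).
  apply: (big_ind2 (fun p a => M (p - a%:MP))).
  - by rewrite mpolyC1 subrr.
  - by move=> q1 a q2 b; apply: MX.
  - move=> i _; elim: (m i) => [|k IHk]; first by rewrite !expr0 mpolyC1 subrr.
    by rewrite !exprS; apply: MX.
exists v; split=> [|p Mp].
  apply/eqP => g0; apply: (@M_avoid 1%N); rewrite expr1.
  by have := Mev g; rewrite g0 subr0.
have [//|pv0] := eqVneq p.@[v] 0; case: (@M_avoid 0%N); rewrite expr0.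
rewrite -[1](_ : (p.@[v])^-1%:MP * (p.@[v])%:MP = _).
  apply: (MM); rewrite -[X in M X](subKr p); apply: is_idealB => //.
by rewrite -mpolyCM mulVf.
Qed.

End Nullstellensatz.

(** An ideal containing [S] and maximal among those avoiding the powers of [g] corresponds to a
    maximal ideal of the localization at [g]. It yields a zero of [S] at which [g] does not
    vanish. *)
Lemma nullstellensatz (R : realType) (n : nat) (S : set {mpoly R[i][n]})
    (g : {mpoly R[i][n]}) :
  (forall v, (forall s, S s -> s.@[v] = 0) -> g.@[v] = 0) ->
  exists k, ideal_span S (g ^+ k).
Proof.
move=> Sg; apply: contrapT => nk.
have [||M [M_ideal SM Mg] Mmax] := @noetherian_max _ [set J |
  [/\ is_ideal J, S `<=` J & forall k, ~ J (g ^+ k)]] (@noetherian_mpoly _ n).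
- exists (ideal_span S); split; [exact: ideal_span_ideal|exact: sub_ideal_span|].
  by move=> k Sgk; apply: nk; exists k.
- by move=> J [].
have [|v [gv /(_ _ (SM _ _)) Mv]] := @max_avoid_point _ _ g M M_ideal Mg.
  move=> J iJ Jg MJ; apply: Mmax => //; split=> //.
  exact: subset_trans MJ.
by case/eqP: gv; apply: Sg => s /Mv.
Qed.

(** * Hilbert functions *)

Section HilbertFunction.
Variables (K : fieldType) (n : nat).
Local Notation T := {mpoly K[n]}.
Implicit Types (J : set T) (g p q h u : T) (d e k a b : nat).

Definition graded J : Prop := forall p d, J p -> J (pihomog mdeg d p).

Definition ideal_add J g : set T := [set p | exists u, J (p - g * u)].

(** [indep_mod] and [spanned_mod] bound the Hilbert function of the quotient by [J] in degree [d]
    from below and from above, without forming quotient spaces. *)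
Definition indep_mod J d k : Prop := exists u : 'I_k -> T,
  (forall i, u i \is d.-homog) /\
  forall c : 'I_k -> K, J (\sum_i c i *: u i) -> forall i, c i = 0.

Definition spanned_mod J d k : Prop := exists w : 'I_k -> T,
  (forall i, w i \is d.-homog) /\
  forall h, h \is d.-homog -> exists c : 'I_k -> K, J (h - \sum_i c i *: w i).

Lemma is_idealZ J c p : is_ideal J -> J p -> J (c *: p).
Proof. by case=> _ _ JM Jp; rewrite -mul_mpolyC; apply: JM. Qed.

Lemma pihomogMl g e d p : g \is e.-homog ->
  pihomog mdeg (d + e) (g * p) = g * pihomog mdeg d p.
Proof.
move=> ge; have [k] : exists k, (msize p <= k)%N by exists (msize p).
move=> pk; rewrite {1}(pihomog_partitionE (mf := mdeg) pk) mulr_sumr raddf_sum /=.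
have piE (i : nat) : pihomog mdeg (d + e) (g * pihomog mdeg i p) =
    if i == d then g * pihomog mdeg d p else 0.
  have gi : g * pihomog mdeg i p \is (e + i).-homog.
    by apply: dhomogM => //; apply: pihomogP.
  have [->|id] := eqVneq i d.
    by rewrite pihomog_dE // addnC dhomogM // pihomogP.
  by rewrite (pihomog_ne0 _ gi) // addnC eqn_add2r.
under eq_bigr do rewrite piE.
have [dk|kd] := ltnP d k; last first.
  rewrite big1 => [|i _]; last by rewrite ltn_eqF // (leq_trans _ kd).
  rewrite (_ : pihomog _ _ _ = 0) ?mulr0 // pihomogE big_seq_cond big1 //.
  move=> m /andP[mp /eqP md]; have := msize_mdeg_lt mp; rewrite md ltnNge.
  by rewrite (leq_trans pk).
rewrite (bigD1 (Ordinal dk)) //= eqxx big1 ?addr0 // => i.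
by rewrite -val_eqE /= => /negPf ->.
Qed.

Lemma pihomogMl_small g e d p : g \is e.-homog -> (d < e)%N ->
  pihomog mdeg d (g * p) = 0.
Proof.
move=> ge de; rewrite (pihomog_partitionE (mf := mdeg) (leqnn (msize p))).
rewrite mulr_sumr raddf_sum big1 //= => i _.
have gi : g * pihomog mdeg i p \is (e + i).-homog.
  by apply: dhomogM => //; apply: pihomogP.
by rewrite (pihomog_ne0 _ gi) // gtn_eqF // ltn_addr.
Qed.

Lemma ideal_add_ideal J g : is_ideal J -> is_ideal (ideal_add J g).
Proof.
move=> [J0 JD JM]; split; first by exists 0; rewrite mulr0 subr0.
  move=> p q [u Ju] [v Jv]; exists (u + v).
  by rewrite mulrDr opprD addrACA; apply: JD.
by move=> a p [u Ju]; exists (a * u); rewrite mulrCA -mulrBr; apply: JM.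
Qed.

Lemma sub_ideal_add J g : J `<=` ideal_add J g.
Proof. by move=> p Jp; exists 0; rewrite mulr0 subr0. Qed.

Lemma mem_ideal_add J g : is_ideal J -> ideal_add J g g.
Proof. by case=> J0 _ _; exists 1; rewrite mulr1 subrr. Qed.

Lemma ideal_add_graded J g e : g \is e.-homog -> graded J -> graded (ideal_add J g).
Proof.
move=> ge grJ p d [u Jpu]; have := grJ _ d Jpu; rewrite raddfB /=.
have [de|ed] := ltnP d e.
  by rewrite (pihomogMl_small _ ge de) => Jp; exists 0; rewrite mulr0.
by rewrite -{2}(subnK ed) (pihomogMl _ _ ge); exists (pihomog mdeg (d - e) u).
Qed.

Lemma indep_le_spanned J d a b :
  is_ideal J -> indep_mod J d a -> spanned_mod J d b -> (a <= b)%N.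
Proof.
move=> iJ [u [ud uJ]] [w [wd wJ]]; rewrite leqNgt; apply/negP => ba.
have [C hC] := choice (fun i => wJ _ (ud i)).
have [v v0 vC] := left_kernel_exists (\matrix_(i, j) C i j) ba.
have /rV0Pn [j vj] := v0; case/eqP: vj; move: j.
apply: (uJ (v ord0)).
have -> : \sum_i v ord0 i *: u i =
    \sum_i v ord0 i *: (u i - \sum_j C i j *: w j).
  under [RHS]eq_bigr do rewrite scalerBr scaler_sumr.
  rewrite sumrB exchange_big /= [X in _ - X]big1 ?subr0 // => j _.
  under eq_bigr do rewrite scalerA.
  rewrite -scaler_suml; have /rowP/(_ j) := vC; rewrite !mxE.
  under eq_bigr do rewrite mxE.
  by move->; rewrite scale0r.
by apply: is_ideal_sum => // i _; apply: is_idealZ.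
Qed.

(** Multiplication by [g] is injective modulo [J] and zero modulo [J'], so lower bounds add up:
    reading a relation modulo [J'] kills the coefficients of the second family, then [g] is
    cancelled. *)
Lemma indep_step J J' g d e a b : is_ideal J' -> J `<=` J' -> J' g ->
  g \is e.-homog -> (forall p, J (g * p) -> J p) ->
  indep_mod J d a -> indep_mod J' (d + e) b -> indep_mod J (d + e) (a + b).
Proof.
move=> iJ' JJ' J'g ge greg [u [ud uJ]] [w [wd wJ]].
exists (fun i : 'I_(a + b) =>
  match fintype.split i with inl j => g * u j | inr j => w j end); split.
  move=> i; case: fintype.split => j //.
  by rewrite addnC; apply: dhomogM.
move=> c; rewrite big_split_ord /=.
have sl (i : 'I_a) : fintype.split (lshift b i) = inl i by apply: (unsplitK (inl i)).
have sr (i : 'I_b) : fintype.split (rshift a i) = inr i by apply: (unsplitK (inr i)).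
under eq_bigr do rewrite sl; under [X in _ + X]eq_bigr do rewrite sr.
have -> : \sum_(i < a) c (lshift b i) *: (g * u i) =
    g * \sum_(i < a) c (lshift b i) *: u i.
  by rewrite mulr_sumr; apply: eq_bigr => i _; rewrite scalerAr.
move=> Jc.
have c2 i : c (rshift a i) = 0.
  apply: (wJ (fun i => c (rshift a i))).
  rewrite -[X in J' X](addKr (g * \sum_(i < a) c (lshift b i) *: u i)).
  rewrite [X in J' X]addrC; apply: is_idealB => //; first exact: JJ'.
  exact: is_idealMr.
move: Jc; rewrite [X in _ + X]big1 ?addr0 => [/greg Jc i|i _]; last first.
  by rewrite c2 scale0r.
have c1 := uJ (fun i => c (lshift b i)) Jc.
by rewrite -(splitK i); case: (fintype.split i) => j /=.
Qed.

Lemma spanned_leq J d a b : (a <= b)%N -> spanned_mod J d a -> spanned_mod J d b.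
Proof.
move=> /subnKC <-; move: (b - a)%N => r [w [wd wJ]].
exists (fun i : 'I_(a + r) => if fintype.split i is inl j then w j else 0); split.
  by move=> i; case: fintype.split => j //; apply: dhomog0.
move=> h /wJ[c Jc].
exists (fun i : 'I_(a + r) => if fintype.split i is inl j then c j else 0).
rewrite big_split_ord /= [X in _ - (_ + X)]big1 ?addr0 => [|i _]; last first.
  have -> : fintype.split (rshift a i) = inr i by apply: (unsplitK (inr i)).
  by rewrite scaler0.
have sl (i : 'I_a) : fintype.split (lshift r i) = inl i by apply: (unsplitK (inl i)).
by rewrite (eq_bigr (fun i => c i *: w i)) => [|i _]; rewrite ?sl.
Qed.

Lemma spanned_step_small J g d e b : is_ideal J -> graded J -> g \is e.-homog ->
  (d < e)%N -> spanned_mod (ideal_add J g) d b -> spanned_mod J d b.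
Proof.
move=> iJ grJ ge de [w [wd wJ]]; exists w; split=> // h hd.
have [c [u Jc]] := wJ h hd; exists c.
have := grJ _ d Jc; rewrite raddfB /= (pihomogMl_small _ ge de) subr0.
by rewrite pihomog_dE // rpredB // rpred_sum // => i _; apply: dhomogZ.
Qed.

(** A form of degree d + e is, modulo J + (g), a combination of the second family; the remainder is
    [g] times a form of degree d modulo [J]. *)
Lemma spanned_step J g d e a b : is_ideal J -> graded J -> g \is e.-homog ->
  spanned_mod J d a -> spanned_mod (ideal_add J g) (d + e) b ->
  spanned_mod J (d + e) (a + b).
Proof.
move=> iJ grJ ge [u [ud uJ]] [w [wd wJ]]; have [J0 JD JM] := iJ.
exists (fun i : 'I_(a + b) =>
  match fintype.split i with inl j => g * u j | inr j => w j end); split.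
  move=> i; case: fintype.split => j //.
  by rewrite addnC; apply: dhomogM.
move=> h hd; have [c2 [v Jv]] := wJ h hd.
have := grJ _ (d + e)%N Jv; rewrite raddfB /= (pihomogMl _ _ ge).
rewrite pihomog_dE; last first.
  by rewrite rpredB // rpred_sum // => i _; apply: dhomogZ.
have [c1 Jc1] := uJ _ (pihomogP mdeg d v) => Jh.
exists (fun i : 'I_(a + b) =>
  match fintype.split i with inl j => c1 j | inr j => c2 j end).
have sl (i : 'I_a) : fintype.split (lshift b i) = inl i by apply: (unsplitK (inl i)).
have sr (i : 'I_b) : fintype.split (rshift a i) = inr i by apply: (unsplitK (inr i)).
rewrite big_split_ord /=.
under eq_bigr do rewrite sl; under [X in _ - (_ + X)]eq_bigr do rewrite sr.
have -> : \sum_(i < a) c1 i *: (g * u i) = g * \sum_(i < a) c1 i *: u i.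
  by rewrite mulr_sumr; apply: eq_bigr => i _; rewrite scalerAr.
set U := \sum_i c1 i *: u i in Jc1 *; set W := \sum_i c2 i *: w i in Jh *.
rewrite (_ : h - _ = (h - W - g * pihomog mdeg d v) + g * (pihomog mdeg d v - U));
  last by ring.
by apply: JD => //; apply: JM.
Qed.

Lemma spanned_all J d : is_ideal J -> exists k, spanned_mod J d k.
Proof.
case=> J0 _ _; exists #|{: 'X_{1..n < d.+1}}|.
exists (fun i => let m := bmnm (enum_val i) in if mdeg m == d then 'X_[m] else 0).
split=> [i /=|h hd]; first by case: ifP => [md|_]; rewrite ?dhomogX ?dhomog0.
exists (fun i => h@_(bmnm (enum_val i))).
rewrite (_ : \sum_i _ = h) ?subrr //.
rewrite -(big_enum_val (A := {: 'X_{1..n < d.+1}}) (fun m : 'X_{1..n < d.+1} =>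
   h@_m *: (if mdeg m == d then 'X_[m] else 0))) /=.
have hs : (msize h <= d.+1)%N.
  rewrite msizeE; apply/bigmax_leqP_seq => m mh _.
  by rewrite (dhomog_mf hd mh).
rewrite [RHS](mpolywE hs); apply: eq_bigr => m _.
case: ifPn => // md; rewrite scaler0.
by rewrite (dhomog_nemf_coeff hd md) scale0r.
Qed.

(** On generating series this is multiplication by 1 / (1 - t), the effect on Hilbert series bounds
    of removing one generator of step degree. *)
Definition cumul (b : nat -> nat) (D : nat) : nat := (\sum_(i < D.+1) b i)%N.

Lemma spanned_cumul J g e (b : nat -> nat) : is_ideal J -> graded J ->
  (0 < e)%N -> g \is e.-homog ->
  (forall D, spanned_mod (ideal_add J g) (D * e) (b D)) ->
  forall D, spanned_mod J (D * e) (cumul b D).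
Proof.
move=> iJ grJ e0 ge hb; elim=> [|D IH].
  (* Degree 0 lies below the degree [e] of [g], where [J] and J + (g) have the same forms. *)
  rewrite /cumul big_ord1; apply: spanned_step_small ge _ _ => //.
rewrite /cumul big_ord_recr /= mulSnr.
by apply: (spanned_step iJ grJ ge IH); rewrite -mulSnr.
Qed.

Fixpoint ideal_adds J (gs : seq T) : set T :=
  if gs is g :: gs' then ideal_adds (ideal_add J g) gs' else J.

Lemma ideal_adds_ideal J gs : is_ideal J -> is_ideal (ideal_adds J gs).
Proof. by elim: gs J => //= g gs IH J iJ; apply/IH/ideal_add_ideal. Qed.

Lemma sub_ideal_adds J gs : J `<=` ideal_adds J gs.
Proof.
elim: gs J => [|g gs IH] J /=; first exact: subset_refl.
by apply: subset_trans (IH _); apply: sub_ideal_add.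
Qed.

Lemma mem_ideal_adds J gs g : is_ideal J -> g \in gs -> ideal_adds J gs g.
Proof.
elim: gs J => //= g' gs IH J iJ; rewrite inE => /orP[/eqP -> | ggs].
  by apply: sub_ideal_adds; apply: mem_ideal_add.
by apply: IH => //; apply: ideal_add_ideal.
Qed.

Lemma spanned_adds J e (gs : seq T) (b : nat -> nat) : is_ideal J -> graded J ->
  (0 < e)%N -> (forall g, g \in gs -> g \is e.-homog) ->
  (forall D, spanned_mod (ideal_adds J gs) (D * e) (b D)) ->
  forall D, spanned_mod J (D * e) (iter (size gs) cumul b D).
Proof.
move=> iJ grJ e0; elim: gs J iJ grJ => //= g gs IH J iJ grJ gse hb.
have ge : g \is e.-homog by apply: gse; rewrite mem_head.
apply: (spanned_cumul iJ grJ e0 ge); apply: IH => //.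
- exact: ideal_add_ideal.
- exact: ideal_add_graded ge grJ.
- by move=> g' g's; apply: gse; rewrite inE g's orbT.
Qed.

Lemma spanned_eventually0 J N0 : is_ideal J ->
  (forall d h, (N0 <= d)%N -> h \is d.-homog -> J h) ->
  exists c, forall d, spanned_mod J d (if (d < N0)%N then c else 0%N).
Proof.
move=> iJ hJ; have [k hk] := choice (fun d => spanned_all d iJ).
exists (\max_(d < N0) k d) => d; case: ltnP => dN.
  by apply: spanned_leq (hk d); apply: (leq_bigmax (Ordinal dN)).
exists (fun=> 0); split=> [i|h hd]; first exact: dhomog0.
by exists (fun=> 0); rewrite big_ord0 subr0; apply: hJ hd.
Qed.

End HilbertFunction.

(** The first summation of a finitely supported function is bounded by its total c N0; each of the
    other m raises the order of growth by one. *)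
Lemma cumul_bound (b : nat -> nat) (c N0 m D : nat) :
  (forall D, b D <= if D < N0 then c else 0)%N ->
  (iter m.+1 cumul b D <= c * N0 * D.+1 ^ m)%N.
Proof.
move=> hb; elim: m D => [|m IH] D.
  rewrite expn0 muln1 /= /cumul.
  apply: (@leq_trans (c * minn D.+1 N0)); last by rewrite leq_mul2l geq_minr orbT.
  elim: D.+1 => [|k IH]; first by rewrite big_ord0.
  rewrite big_ord_recr /=; apply: leq_trans (leq_add IH (hb k)) _.
  case: ltnP => kN; last by rewrite addn0 (minn_idPr _) // leqW.
  by rewrite (minn_idPl kN) mulnS addnC.
rewrite iterS {1}/cumul; apply: (@leq_trans (\sum_(i < D.+1) c * N0 * D.+1 ^ m)%N).
  apply: leq_sum => i _; apply: leq_trans (IH i) _.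
  rewrite leq_mul2l; apply/orP; right; case: (m) => [|e]; first by rewrite !expn0. by rewrite leq_exp2r. 
by rewrite sum_nat_const card_ord expnS mulnCA.
Qed.

Lemma expn_le_bin (D j : nat) : (D.+1 ^ j <= 'C(D + j, j) * j`!)%N.
Proof.
rewrite bin_ffact; elim: j => [|j IH] //.
by rewrite addnS ffactSS expnS leq_mul // ltnS leq_addr.
Qed.

Lemma bin_growth (c m j : nat) :
  (forall D, 'C(D + j, j) <= c * D.+1 ^ m)%N -> (j <= m)%N.
Proof.
(* With this [D] the bounds give (D + 1)^j <= D (D + 1)^m, impossible for m < j. *)
move=> hC; rewrite leqNgt; apply/negP => mj; pose D := (c * j`!)%N.
have := leq_trans (expn_le_bin D j) (leq_mul (hC D) (leqnn _)).
rewrite mulnAC -/D -(subnK mj) addnS expnS expnD mulnA.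
rewrite leq_pmul2r ?expn_gt0 // leqNgt => /negP; apply.
by apply: leq_pmulr; rewrite expn_gt0.
Qed.

Lemma poly_eq0_eval (K : numFieldType) (p : {poly K}) :
  (forall c, p.[c] = 0) -> p = 0.
Proof.
move=> p0; apply/eqP; apply: contraT => pn0.
have := max_poly_roots pn0 (rs := [seq i%:R | i <- iota 0 (size p)]).
rewrite size_map size_iota ltnn => -> //.
  by apply/allP => c _; apply/eqP/p0.
by rewrite map_inj_uniq ?iota_uniq //; apply: mulrIn; rewrite oner_eq0.
Qed.

Lemma meval_scale (K : fieldType) (n d : nat) (g : {mpoly K[n]}) c (w : 'I_n -> K) :
  g \is d.-homog -> g.@[fun i => c * w i] = c ^+ d * g.@[w].
Proof.
move=> gd; rewrite !mevalE mulr_sumr; apply: eq_big_seq => m mg.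
rewrite mulrCA; congr (_ * _).
under eq_bigr do rewrite exprMn; rewrite big_split /=; congr (_ * _).
by rewrite prodrXr -mdegE (dhomog_mf gd mg).
Qed.

Section ConeIdeal.
Variables (K : numFieldType) (n : nat).
Implicit Types (W : set ('I_n -> K)) (g p : {mpoly K[n]}).

Definition is_cone W : Prop := forall w c, W w -> W (fun i => c * w i).

Definition cone_ideal W : set {mpoly K[n]} := [set g | forall w, W w -> g.@[w] = 0].

Lemma cone_ideal_ideal W : is_ideal (cone_ideal W).
Proof.
split=> [w _|p q Jp Jq w Ww|a p Jp w Ww]; first exact: meval0.
  by rewrite mevalD Jp ?Jq ?addr0.
by rewrite mevalM Jp ?mulr0.
Qed.

(** For w in the cone, p(c w) is a polynomial in c whose coefficients are the values at w of the
    homogeneous components; it vanishes for every c. *)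
Lemma cone_ideal_graded W : is_cone W -> graded (cone_ideal W).
Proof.
move=> cW p d Jp w Ww.
pose r : {poly K} := \poly_(i < msize p) (pihomog mdeg i p).@[w].
have r0 : r = 0.
  apply: poly_eq0_eval => c; rewrite horner_poly.
  rewrite -[RHS](Jp _ (cW _ c Ww)).
  rewrite [in RHS](pihomog_partitionE (mf := mdeg) (leqnn (msize p))).
  rewrite raddf_sum /=; apply: eq_bigr => i _.
  by rewrite (meval_scale _ _ (pihomogP _ _ _)) mulrC.
have [dp|pd] := ltnP d (msize p).
  by have := coef_poly (msize p) (fun i => (pihomog mdeg i p).@[w]) d;
    rewrite -/r r0 coef0 dp.
rewrite pihomogE big_seq_cond big1 ?meval0 // => m /andP[mp /eqP md].
by have := msize_mdeg_lt mp; rewrite md ltnNge pd.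
Qed.

End ConeIdeal.

Lemma homog_mem_ideal (K : fieldType) (n : nat) (I : set {mpoly K[n]}) :
  is_ideal I -> (forall i, exists k, I ('X_i ^+ k)) ->
  exists N0, forall d h, (N0 <= d)%N -> h \is d.-homog -> I h.
Proof.
move=> iI /choice[k hk]; exists (\sum_i k i).+1 => d h Nd hd.
rewrite [h]mpolyE big_seq; apply: is_ideal_sum => // m mh.
apply: is_idealZ => //; have md : mdeg m = d := dhomog_mf hd mh.
have [i ki] : exists i, (k i <= m i)%N.
  apply: contrapT => nk; move: Nd; rewrite -md mdegE ltnNge => /negP; apply.
  apply: leq_sum => i _; rewrite leqNgt; apply/negP => /ltnW ki.
  by apply: nk; exists i.
rewrite mpolyXE_id (bigD1 i) //= -(subnK ki) exprD mulrAC mulrC.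
by apply: is_idealMr.
Qed.

(** By the Nullstellensatz J + (gs) contains all forms of large degree. Putting the forms of [gs]
    back one at a time bounds the Hilbert function of [J] by a polynomial of degree [size gs - 1],
    against growth of order k. *)
Lemma dim_bound (R : realType) (n : nat) (J : set {mpoly R[i][n]})
    (gs : seq {mpoly R[i][n]}) (e k : nat) :
  is_ideal J -> graded J -> (forall g, g \in gs -> g \is 1.-homog) ->
  (forall w, (forall p, J p -> p.@[w] = 0) -> (forall g, g \in gs -> g.@[w] = 0) ->
     forall i, w i = 0) ->
  (0 < e)%N -> (forall D, indep_mod J (D * e) 'C(D + k, k)) -> (k < size gs)%N.
Proof.
move=> iJ grJ gs1 gs0 e0 hind.
have iA := ideal_adds_ideal gs iJ.
have [N0 hN0] : exists N0, forall d h, (N0 <= d)%N -> h \is d.-homog -> ideal_adds J gs h.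
  apply: homog_mem_ideal => // i.
  have [w hw|l hl] := @nullstellensatz R n (J `|` [set` gs]) 'X_i.
    rewrite mevalXU; apply: gs0 => [p Jp|g ggs]; apply: hw; first by left.
    by right.
  exists l; apply: (ideal_span_min iA) hl => p [Jp|pgs].
    exact: sub_ideal_adds.
  exact: mem_ideal_adds.
have [c hc] := spanned_eventually0 iA hN0.
have hsp D : spanned_mod J D (iter (size gs) cumul (fun d => if (d < N0)%N then c else 0%N) D).
  rewrite -[X in spanned_mod J X _]muln1; apply: spanned_adds => // D'.
  by rewrite muln1.
have hle D := indep_le_spanned iJ (hind D) (hsp _).
case: (size gs) hle => [|m] hle.
  (* With no forms at all, [J] contains every form of degree N0 e, whereas a binomial coefficient is
     positive. *)
  have := hle N0; rewrite /= ltnNge leq_pmulr //= leqn0 -leqn0 leqNgt.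
  by rewrite bin_gt0 leq_addl.
rewrite ltnS; apply: (@bin_growth (c * N0 * e ^ m)) => D.
apply: leq_trans (hle D) _; apply: leq_trans (cumul_bound (c := c) (N0 := N0) m _ _) _.
  by move=> d.
rewrite -[X in (_ <= X)%N]mulnA leq_mul2l -expnMn; apply/orP; right.
case: (m) => [|m']; first by rewrite !expn0.
by rewrite leq_exp2r // mulnS -add1n [(D * e)%N]mulnC leq_add2r.
Qed.

(** * Chains of irreducible closed sets *)

Lemma indep_leq (K : fieldType) (n : nat) (J : set {mpoly K[n]}) (d a b : nat) :
  is_ideal J -> (a <= b)%N -> indep_mod J d b -> indep_mod J d a.
Proof.
move=> [J0 _ _] /subnKC <-; move: (b - a)%N => r [u [ud uJ]].
exists (fun i => u (lshift r i)); split=> // c Jc i.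
have := uJ (fun i => if fintype.split i is inl j then c j else 0) _ (lshift r i).
have sl (j : 'I_a) : fintype.split (lshift r j) = inl j by apply: (unsplitK (inl j)).
have sr (j : 'I_r) : fintype.split (rshift a j) = inr j by apply: (unsplitK (inr j)).
rewrite sl; apply; rewrite big_split_ord /= [X in _ + X]big1 ?addr0.
  by rewrite (eq_bigr (fun i => c i *: u (lshift r i))) // => j _; rewrite sl.
by move=> j _; rewrite sr scale0r.
Qed.

Section Projective.
Variables (R : realType) (n : nat).
Local Notation C := R[i].
Local Notation T := {mpoly R[i][n.+1]}.
Local Notation PS := (proj_space R n).
Implicit Types (L : PS) (Z F : set PS) (g p : T) (v x : 'rV[C]_n.+1).

Definition cone_of Z : set ('I_n.+1 -> C) :=
  [set w | exists L, exists x, [/\ Z L, x \in val L & w = x ord0]].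

Definition van Z : set T := cone_ideal (cone_of Z).

Lemma vanP Z g : van Z g <-> forall L x, Z L -> x \in val L -> g.@[x ord0] = 0.
Proof.
split=> [vg L x ZL xL|vg _ [L [x [ZL xL ->]]]]; last exact: vg ZL xL.
by apply: vg; exists L, x.
Qed.

Lemma van_zeros Z g : van Z g <-> Z `<=` zeros [set g].
Proof.
split=> [/vanP vg L ZL _ -> x xL|Zg]; first exact: vg ZL xL.
by apply/vanP => L x /Zg; apply.
Qed.

Lemma cone_of_cone Z : is_cone (cone_of Z).
Proof.
move=> _ c [L [x [ZL xL ->]]]; exists L, (c *: x); split=> //.
  exact: memvZ.
by apply/funext => i; rewrite !mxE.
Qed.

Lemma van_ideal Z : is_ideal (van Z).
Proof. exact: cone_ideal_ideal. Qed.

Lemma van_graded Z : graded (van Z).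
Proof. by apply: cone_ideal_graded; apply: cone_of_cone. Qed.

Lemma van_sub Z F : Z `<=` F -> van F `<=` van Z.
Proof. by move=> ZF g /vanP vg; apply/vanP => L x /ZF; apply: vg. Qed.

Lemma proj_spaceP L : exists2 v, v != 0 & val L = <[v]>%VS.
Proof.
have dL : \dim (val L) = 1%N := eqP (valP L).
have v0 : vpick (val L) != 0 by rewrite vpick0 -dimv_eq0 dL.
exists (vpick (val L)) => //; apply/esym/eqP.
rewrite eqEdim dL dim_vline v0 andbT -memvE; exact: memv_pick.
Qed.

Definition proj_point v (v0 : v != 0) : PS :=
  exist (fun L : {vspace 'rV[C]_n.+1} => \dim L == 1%N) <[v]>%VS
    (introT eqP (etrans (dim_vline v) (congr1 nat_of_bool v0))).

Lemma zeros1P L v g d : v != 0 -> v \in val L -> g \is d.-homog ->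
  zeros [set g] L <-> g.@[v ord0] = 0.
Proof.
move=> v0 vL gd; split=> [/(_ g erefl v vL) //|gv0 _ -> x xL].
have [w w0 Lw] := proj_spaceP L; move: vL xL; rewrite Lw.
move=> /vlineP[a va] /vlineP[b xb].
have a0 : a != 0 by apply: contraNneq v0 => a0; rewrite va a0 scale0r.
have -> : x ord0 = fun i => b / a * v ord0 i.
  by apply/funext => i; rewrite xb va !mxE mulrA mulfVK.
by rewrite (meval_scale _ _ gd) gv0 mulr0.
Qed.

Lemma zeros_sub (S S' : set T) : S `<=` S' -> zeros S' `<=` @zeros R n S.
Proof. by move=> SS' L ZL g /SS'; apply: ZL. Qed.

Lemma zeros_setU (S S' : set T) : zeros (S `|` S') = zeros S `&` @zeros R n S'.
Proof.
apply/seteqP; split=> [L ZL|L [ZL ZL'] g [/ZL|/ZL']] //.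
by split; apply: zeros_sub ZL => g ?; [left|right].
Qed.

Lemma zeros_set1 (S : set T) L : zeros S L <-> forall g, S g -> zeros [set g] L.
Proof.
split=> [ZL g Sg|ZL g Sg]; last exact: (ZL g Sg g).
by move=> _ ->; apply: ZL.
Qed.

Lemma zeros_ideal_span (S : set T) : zeros (ideal_span S) = @zeros R n S.
Proof.
apply/seteqP; split; first exact/zeros_sub/sub_ideal_span.
move=> L ZL; suff : ideal_span S `<=` van [set L].
  by move=> SL g /SL/vanP vg x xL; apply: vg xL.
apply: ideal_span_min; first exact: van_ideal.
by move=> g Sg; apply/vanP => _ x -> xL; apply: ZL.
Qed.

Lemma closed_zeros1 g d : g \is d.-homog -> zariski_closed (@zeros R n [set g]).
Proof. by move=> gd; exists [set g]; split=> // _ ->; exists d. Qed.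

Lemma zariski_closedI Z Z' :
  zariski_closed Z -> zariski_closed Z' -> zariski_closed (Z `&` Z').
Proof.
move=> [S [Sh ->]] [S' [Sh' ->]]; exists (S `|` S').
by rewrite zeros_setU; split=> // g [/Sh|/Sh'].
Qed.

Lemma zariski_closed_notin Z L : zariski_closed Z -> ~ Z L ->
  exists g d, [/\ g \is d.-homog, van Z g & ~ zeros [set g] L].
Proof.
move=> [S [Sh ZS]] nL.
have [g Sg gL] : exists2 g, S g & ~ zeros [set g] L.
  apply: contrapT => ng; apply: nL; rewrite ZS; apply/zeros_set1 => g Sg.
  by apply: contrapT => gL; apply: ng; exists g.
have [d gd] := Sh g Sg; exists g, d; split=> //.
by apply/van_zeros; rewrite ZS; apply: zeros_sub => _ ->.
Qed.

Lemma zariski_closed_nsub Z F : zariski_closed Z -> ~ F `<=` Z ->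
  exists g d, [/\ g \is d.-homog, van Z g & ~ van F g].
Proof.
move=> cZ nFZ; have [L FL nZL] : exists2 L, F L & ~ Z L.
  apply: contrapT => nL; apply: nFZ => L FL.
  by apply: contrapT => nZL; apply: nL; exists L.
have [g [d [gd vg gL]]] := zariski_closed_notin cZ nZL.
by exists g, d; split=> // /van_zeros/(_ L FL).
Qed.

Lemma irr_prime F g d p : zariski_irreducible F -> g \is d.-homog ->
  van F (g * p) -> ~ van F g -> van F p.
Proof.
move=> [_ irrF] gd vgp ng.
(* Irreducibility concerns closed sets defined by forms, so [p] is treated one homogeneous component
   at a time. *)
rewrite (pihomog_partitionE (mf := mdeg) (leqnn (msize p))).
apply: is_ideal_sum => [|i _]; first exact: van_ideal.
have vgi : van F (g * pihomog mdeg i p).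
  by rewrite -(pihomogMl _ _ gd); apply: van_graded.
have [||//|Fg|Fp] := irrF (zeros [set g]) (zeros [set pihomog mdeg i p]).
- exact: closed_zeros1 gd.
- exact/closed_zeros1/pihomogP.
- move=> L FL; have [v v0 Lv] := proj_spaceP L.
  have vL : v \in val L by rewrite Lv memv_line.
  have /vanP/(_ L v FL vL)/eqP := vgi; rewrite mevalM mulf_eq0.
  case/orP => /eqP gv; [left|right].
    exact/(zeros1P v0 vL gd).
  exact/(zeros1P v0 vL (pihomogP _ _ _)).
- by case: ng; apply/van_zeros.
- exact/van_zeros.
Qed.

Lemma irr_primeX F g d k : zariski_irreducible F -> g \is d.-homog ->
  ~ van F g -> ~ van F (g ^+ k).
Proof.
move=> irrF gd ng; elim: k => [|k IH].
  have [[L FL] _] := irrF; have [v v0 Lv] := proj_spaceP L.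
  rewrite expr0 => /vanP/(_ L v FL); rewrite Lv memv_line meval1 => /(_ isT)/eqP.
  by rewrite oner_eq0.
by rewrite exprS => /(irr_prime irrF gd)/(_ ng).
Qed.

Lemma irr_prod F (I : Type) (r : seq I) (g : I -> T) : zariski_irreducible F ->
  (forall i, exists d, g i \is d.-homog) -> (forall i, ~ van F (g i)) ->
  ~ van F (\prod_(i <- r) g i).
Proof.
move=> irrF gh ng; elim: r => [|i r IH].
  rewrite big_nil -(expr0 (1 : T)).
  apply: (irr_primeX (d := 0) irrF); first exact: dhomog1.
  move=> /vanP v1; have [[L FL] _] := irrF; have [v v0 Lv] := proj_spaceP L.
  have := v1 L v FL; rewrite Lv memv_line meval1 => /(_ isT)/eqP.
  by rewrite oner_eq0.
by have [d gd] := gh i; rewrite big_cons => /(irr_prime irrF gd)/(_ (ng i)).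
Qed.

Lemma nonempty_van_coord Z : Z !=set0 -> exists s, ~ van Z 'X_s.
Proof.
move=> [L ZL]; have [v v0 Lv] := proj_spaceP L.
have /rV0Pn [s vs] := v0; exists s => /vanP/(_ L v ZL).
by rewrite Lv memv_line mevalXU => /(_ isT)/eqP; apply/negP.
Qed.

Lemma dhomogXi (s : 'I_n.+1) : ('X_s : T) \is 1.-homog.
Proof. by rewrite dhomogX; apply/eqP; apply: mdeg1. Qed.

Lemma nonempty_indep F d : zariski_irreducible F -> indep_mod (van F) d 1.
Proof.
move=> irrF; have [s ns] := nonempty_van_coord irrF.1.
exists (fun=> 'X_s ^+ d); split.
  by move=> _; have := dhomogMn d (dhomogXi s); rewrite mul1n.
move=> c; rewrite big_ord1 => vc i; apply/eqP; apply: contraT => ci.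
case: (irr_primeX (k := d) irrF (dhomogXi s) ns).
rewrite -['X_s ^+ d](scalerK ci) ord1.
exact: (is_idealZ _ (van_ideal F) vc).
Qed.

(** Take a form vanishing on the member below the top but not on the top: multiplication by it is
    injective on the top, and its cokernel surjects onto the forms on the member below. Pascal's
    rule turns the two inductive bounds into the next binomial coefficient. *)
Lemma chain_growth (F : nat -> set PS) k :
  (forall i, (i <= k)%N -> zariski_closed (F i) /\ zariski_irreducible (F i)) ->
  (forall i, (i < k)%N -> F i `<` F i.+1) ->
  exists2 e, (0 < e)%N & forall D, indep_mod (van (F k)) (D * e) 'C(D + k, k).
Proof.
elim: k => [|k IH] Fci Flt.
  by exists 1%N => // D; rewrite addn0 bin0; apply: nonempty_indep; case: (Fci 0%N).
have [||e e0 he] := IH.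
- by move=> i ik; apply: Fci; apply: leqW.
- by move=> i ik; apply: Flt; apply: leqW.
have [Fsub Fnsub] := Flt k (ltnSn k).
have [clk irrk] := Fci k (leqnSn k); have [clk1 irrk1] := Fci k.+1 (leqnn _).
have [g [d [gd vg nvg]]] := zariski_closed_nsub clk Fnsub.
have [s ns] := nonempty_van_coord irrk1.1.
have gsd : g * 'X_s \is (d + 1).-homog by apply: dhomogM => //; apply: dhomogXi.
have ngs : ~ van (F k.+1) (g * 'X_s) by move=> /(irr_prime irrk1 gd)/(_ nvg).
(* The factor ['X_s] makes the degree positive, and the exponent makes it a multiple of the step [e]
   of the shorter chain. *)
pose h := (g * 'X_s) ^+ e.
have hd : h \is ((d + 1) * e).-homog by apply: dhomogMn.
have nh : ~ van (F k.+1) h by apply: irr_primeX gsd ngs.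
exists ((d + 1) * e)%N; first by rewrite muln_gt0 e0 addn1.
elim=> [|D IHD]; first by rewrite add0n binn; apply: nonempty_indep.
rewrite mulSnr (_ : (D.+1 + k.+1 = (D + k.+1).+1)%N) // binS.
apply: (indep_step (J' := van (F k)) _ _ _ hd) => //.
- exact: van_ideal.
- exact: van_sub.
- by rewrite /h -(prednK e0) exprS -mulrA; exact: (is_idealMr _ (van_ideal (F k)) vg).
- by move=> p /(irr_prime irrk1 hd)/(_ nh).
rewrite -mulSnr mulnA; apply: indep_leq (he _); first exact: van_ideal.
by apply: leq_bin2l; rewrite addnS -addSn leq_add2r mulnDr muln1 leq_addl.
Qed.

Lemma has_irr_chainP Z k : has_irr_chain Z k.+1 <-> exists F : nat -> set PS,
  [/\ forall i, (i <= k)%N -> zariski_closed (F i) /\ zariski_irreducible (F i),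
      F k `<=` Z & forall i, (i < k)%N -> F i `<` F i.+1].
Proof.
split=> [[F [Fci Flt]]|[F [Fci FZ Flt]]].
  exists (fun i => F (inord i)); split=> [i ik||i ik].
  - by have [] := Fci (inord i).
  - by have [] := Fci (inord k).
  - by apply: Flt; rewrite !inordK // ltnS // ltnW.
have Fle i j : (i <= j <= k)%N -> F i `<=` F j.
  case/andP; move=> /subnK <-; elim: (j - i)%N => [_ //|l IH lk].
  apply: subset_trans (IH (ltnW lk)) _.
  by have [] := Flt (l + i)%N lk.
exists (fun i : 'I_k.+1 => F i); split=> [i|i j ij].
  have [ci ii] := Fci i (leq_ord i); split=> //.
  by apply: subset_trans FZ; apply: Fle; rewrite leq_ord leqnn.
have jk := leq_ord j.
have [ij1 nij] := Flt i (leq_trans ij jk).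
split; first by apply: Fle; rewrite (ltnW ij).
move=> ji; apply: nij; apply: subset_trans ji; apply: Fle.
by rewrite ij jk.
Qed.

Lemma has_irr_chain0 Z : has_irr_chain Z 0.
Proof. by exists (fun=> set0); split; case. Qed.

Definition no_common_zero (gs : seq T) Z : Prop :=
  forall L, Z L -> exists2 g, g \in gs & ~ zeros [set g] L.

Lemma row_fun_eq (w : 'I_n.+1 -> C) : (\row_i w i) ord0 = w.
Proof. by apply/funext => i; rewrite mxE. Qed.

Lemma zariski_closed_van Z : zariski_closed Z -> zeros (van Z) `<=` Z.
Proof.
move=> cZ L ZL; apply: contrapT => nL.
have [g [d [_ vg ng]]] := zariski_closed_notin cZ nL.
by apply: ng => _ -> ; apply: ZL.
Qed.

Lemma zeros_van_point Z v (v0 : v != 0) :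
  (forall p, van Z p -> p.@[v ord0] = 0) -> zeros (van Z) (proj_point v0).
Proof.
move=> hv; apply/zeros_set1 => g vg.
have vL : v \in val (proj_point v0) by rewrite memv_line.
suff : van [set proj_point v0] g by move=> /van_zeros; apply.
rewrite (pihomog_partitionE (mf := mdeg) (leqnn (msize g))).
apply: is_ideal_sum => [|i _]; first exact: van_ideal.
apply/van_zeros => _ ->; apply/(zeros1P v0 vL (pihomogP _ _ _)).
by apply: hv; apply: van_graded.
Qed.

Lemma chain_le_size Z (gs : seq T) k :
  (forall g, g \in gs -> g \is 1.-homog) -> no_common_zero gs Z ->
  has_irr_chain Z k -> (k <= size gs)%N.
Proof.
case: k => // k gs1 gsZ /has_irr_chainP[F [Fci FZ Flt]].
have [e e0 he] := chain_growth Fci Flt.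
apply: (dim_bound (van_ideal (F k)) (@van_graded _) gs1 _ e0 he) => w wF wgs i.
apply/eqP; apply: contraT => wi0.
have w0 : \row_i w i != 0 by apply/rV0Pn; exists i; rewrite mxE.
have [g ggs] : exists2 g, g \in gs & ~ zeros [set g] (proj_point w0).
  apply: gsZ; apply: FZ; apply: zariski_closed_van; first by case: (Fci k).
  by apply: zeros_van_point => p vp; rewrite row_fun_eq; apply: wF.
case; apply/(zeros1P w0 _ (gs1 g ggs)); rewrite ?memv_line //.
by rewrite row_fun_eq; apply: wgs.
Qed.

End Projective.

Lemma linear_formE (K : fieldType) (n : nat) (l : {mpoly K[n]}) :
  l \is 1.-homog -> l = \sum_i l@_U_(i) *: 'X_i.
Proof.
move=> l1; apply/mpolyP => m; rewrite raddf_sum /=.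
under eq_bigr do rewrite mcoeffZ mcoeffX.
have [/mdeg1P[j /eqP ->]|md] := boolP (mdeg m == 1%N).
  rewrite (bigD1 j) //= eqxx mulr1 big1 ?addr0 // => i ij.
  by rewrite eq_mnm1 (negPf ij) mulr0.
rewrite (dhomog_nemf_coeff l1 md) big1 // => i _.
case: eqP => [im|]; last by rewrite mulr0.
by case/eqP: md; rewrite -im mdeg1.
Qed.

Lemma linear_form_eval (K : fieldType) (n : nat) (l : {mpoly K[n]}) w :
  l \is 1.-homog -> l.@[w] = \sum_i l@_U_(i) * w i.
Proof.
move=> l1; rewrite {1}(linear_formE l1) raddf_sum /=.
by apply: eq_bigr => i _; rewrite mevalZ mevalXU.
Qed.

(** * Irreducible components, linear sections and Krull dimension *)

Section Dimension.
Variables (R : realType) (n : nat).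
Local Notation C := R[i].
Local Notation T := {mpoly R[i][n.+1]}.
Local Notation PS := (proj_space R n).
Implicit Types (L : PS) (Z F : set PS) (g p l : T) (v x : 'rV[C]_n.+1).

Lemma proj_point_closed L : zariski_closed [set L].
Proof.
have [v v0 Lv] := proj_spaceP L.
pose g (ij : 'I_n.+1 * 'I_n.+1) : T := v ord0 ij.1 *: 'X_ij.2 - v ord0 ij.2 *: 'X_ij.1.
have g1 ij : g ij \is 1.-homog by rewrite rpredB // dhomogZ // dhomogXi.
exists (range g); split=> [_ [ij _ <-]|]; first by exists 1%N.
apply/seteqP; split=> [_ -> _ [ij _ <-] x|L' L'g].
  rewrite Lv => /vlineP[c ->].
  by rewrite /g mevalB !mevalZ !mevalXU !mxE; ring.
apply/val_inj; have [w w0 L'w] := proj_spaceP L'; rewrite L'w Lv.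
have /rV0Pn [s vs] := v0.
have wv : w = (w ord0 s / v ord0 s) *: v.
  apply/rowP => j; rewrite !mxE.
  have /(_ w) := L'g _ (imageT g (s, j)); rewrite L'w memv_line => /(_ isT).
  rewrite /g mevalB !mevalZ !mevalXU /= => /eqP; rewrite subr_eq0 => /eqP e.
  by rewrite mulrAC [w _ s * _]mulrC -e mulrC mulKf.
have a0 : w ord0 s / v ord0 s != 0.
  by apply: contraNneq w0 => a0; rewrite wv a0 scale0r.
apply/eqP; rewrite eqEdim !dim_vline v0 w0 leqnn andbT -memvE wv.
exact: memvZ (memv_line v).
Qed.

Lemma proj_point_irr L : zariski_irreducible [set L].
Proof.
split; first by exists L.
by move=> Z1 Z2 _ _ LZ; have [] := LZ L erefl; [left|right] => _ ->.
Qed.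

(** Noetherian induction: a counterexample with maximal vanishing ideal is nonempty and reducible,
    and its proper closed parts, having larger ideals, do decompose. *)
Lemma irr_decomposition Z : zariski_closed Z ->
  exists r (G : 'I_r -> set PS),
    (forall i, [/\ zariski_closed (G i), zariski_irreducible (G i) & G i `<=` Z]) /\
    forall L, Z L -> exists i, G i L.
Proof.
move=> cZ; apply: contrapT; move: Z cZ.
pose dec Z := exists r (G : 'I_r -> set PS),
    (forall i, [/\ zariski_closed (G i), zariski_irreducible (G i) & G i `<=` Z]) /\
    forall L, Z L -> exists i, G i L.
suff nb : ~ exists Z, zariski_closed Z /\ ~ dec Z.
  by move=> Z cZ nZ; apply: nb; exists Z.
case=> Z0 [cZ0 nZ0].
have [||_ [Z [cZ nZ] <-] Zmax] := @noetherian_max _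
    [set van Z | Z in [set Z | zariski_closed Z /\ ~ dec Z]] (@noetherian_mpoly _ n.+1).
- by exists (van Z0); exists Z0.
- by move=> _ [Z _ <-]; apply: van_ideal.
have sub Z' : zariski_closed Z' -> ~ Z `<=` Z' -> dec (Z `&` Z').
  move=> cZ' ZZ'; apply: contrapT => nd; apply: ZZ'.
  have ZI : van (Z `&` Z') `<=` van Z.
    apply: Zmax; last by apply: van_sub => L [].
    by exists (Z `&` Z') => //; split=> //; apply: zariski_closedI.
  move=> L ZL; suff [] : (Z `&` Z') L by [].
  apply: zariski_closed_van; first exact: zariski_closedI.
  by move=> g /ZI /van_zeros/(_ L ZL); apply.
apply: nZ.
have [[L0 ZL0]|Z_empty] := pselect (Z !=set0); last first.
  exists 0%N, (fun=> set0); split=> [[] //|L ZL].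
  by case: Z_empty; exists L.
have [irrZ|nirr] := pselect (zariski_irreducible Z).
  exists 1%N, (fun=> Z); split=> [_|L ZL]; last by exists ord0.
  by split=> //; apply: subset_refl.
have [Z1 [Z2 [c1 c2 Z12 n1 n2]]] : exists Z1 Z2, [/\ zariski_closed Z1,
    zariski_closed Z2, Z `<=` Z1 `|` Z2, ~ Z `<=` Z1 & ~ Z `<=` Z2].
  apply: contrapT => nex; apply: nirr; split; first by exists L0.
  move=> Z1 Z2 c1 c2 Z12; apply: contrapT => /not_orP[n1 n2].
  by apply: nex; exists Z1, Z2.
have [r1 [G1 [G1P Z1G]]] := sub _ c1 n1.
have [r2 [G2 [G2P Z2G]]] := sub _ c2 n2.
exists (r1 + r2)%N, (fun i : 'I_(r1 + r2) =>
  match fintype.split i with inl j => G1 j | inr j => G2 j end).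
split=> [i|L ZL].
  case: fintype.split => j; [have [a b c] := G1P j | have [a b c] := G2P j];
    by split=> // L /c[].
have [Z1L|Z2L] := Z12 L ZL.
  have [i Gi] := Z1G L (conj ZL Z1L); exists (lshift r2 i).
  by have -> : fintype.split (lshift r2 i) = inl i by apply: (unsplitK (inl i)).
have [i Gi] := Z2G L (conj ZL Z2L); exists (rshift r1 i).
by have -> : fintype.split (rshift r1 i) = inr i by apply: (unsplitK (inr i)).
Qed.

(** The form is sought on the moment curve, with coefficients 1, c, ..., c^n. Its value at [v i] is
    a nonzero polynomial in c, so some c works for all i. *)
Lemma generic_linear_form r (v : 'I_r -> 'rV[C]_n.+1) : (forall i, v i != 0) ->
  exists2 l, l \is 1.-homog & forall i, l.@[v i ord0] != 0.
Proof.
move=> v0; pose P i : {poly C} := \poly_(j < n.+1) v i ord0 (inord j).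
have P0 i : P i != 0.
  have /rV0Pn [s vs] := v0 i; apply: contraNneq vs => Pi0.
  have := coef_poly n.+1 (fun j => v i ord0 (inord j)) s.
  by rewrite -/(P i) Pi0 coef0 ltn_ord inord_val => <-.
have [c Pc] : exists c, (\prod_i P i).[c] != 0.
  apply: contrapT => nc.
  have : \prod_i P i != 0 by apply/prodf_neq0 => i _.
  case/eqP; apply: poly_eq0_eval => c; apply/eqP; apply: contraT => Pc.
  by case: nc; exists c.
exists (\sum_(j < n.+1) c ^+ j *: 'X_j).
  by apply: rpred_sum => j _; apply: dhomogZ; apply: dhomogXi.
move=> i; rewrite raddf_sum /=.
move: Pc; rewrite horner_prod => /prodf_neq0/(_ i isT).
rewrite horner_poly; congr (_ != 0); apply: eq_bigr => j _.
by rewrite mevalZ mevalXU inord_val mulrC.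
Qed.

Lemma irr_sub_union F r (G : 'I_r -> set PS) : zariski_irreducible F ->
  (forall i, zariski_closed (G i)) -> (forall L, F L -> exists i, G i L) ->
  exists i, F `<=` G i.
Proof.
move=> irrF cG FG; apply: contrapT => nF.
have hg i : {g : T | exists d, [/\ g \is d.-homog, van (G i) g & ~ van F g]}.
  apply: cid; apply: zariski_closed_nsub => // FGi.
  by apply: nF; exists i.
pose g i := sval (hg i).
apply: (@irr_prod _ _ F _ (index_enum _) g irrF).
- by move=> i; have [d []] := svalP (hg i); exists d.
- by move=> i; have [d []] := svalP (hg i).
apply/vanP => L x FL xL; have [i GiL] := FG L FL.
have [d [_ /vanP vg _]] := svalP (hg i).
rewrite (bigD1 i) //= mevalM (vg L x GiL xL) mul0r.
by [].
Qed.

Lemma has_irr_chainS Z k : has_irr_chain Z k.+1 -> has_irr_chain Z k.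
Proof.
case=> F [FP Flt]; exists (fun i => F (widen_ord (leqnSn k) i)); split=> //.
by move=> i j ij; apply: Flt.
Qed.

Lemma has_irr_chain_leq Z j k : (j <= k)%N -> has_irr_chain Z k -> has_irr_chain Z j.
Proof.
move=> /subnK <-; elim: (k - j)%N => [//|l IH] /has_irr_chainS; exact: IH.
Qed.

Lemma no_chain_forms Z m : zariski_closed Z -> ~ has_irr_chain Z m.+1 ->
  exists gs : seq T, [/\ size gs = m, forall g, g \in gs -> g \is 1.-homog
                       & no_common_zero gs Z].
Proof.
elim: m Z => [|m IH] Z cZ nch.
  exists [::]; split=> // L ZL; case: nch; apply/has_irr_chainP.
  exists (fun=> [set L]); split=> //.
    by split; [apply: proj_point_closed|apply: proj_point_irr].
  by move=> _ ->.
have [r [G [GP ZG]]] := irr_decomposition cZ.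
have hv i : {v : 'rV[C]_n.+1 | v != 0 /\ exists L, G i L /\ v \in val L}.
  apply: cid; have [_ [[L GL] _] _] := GP i.
  have [v v0 Lv] := proj_spaceP L; exists v; split=> //.
  by exists L; split=> //; rewrite Lv memv_line.
pose v i := sval (hv i).
have [|l l1 lv] := @generic_linear_form r v; first by move=> i; case: (svalP (hv i)).
have [||gs [sgs gs1 gsZ]] := IH (Z `&` zeros [set l]).
- by apply: zariski_closedI => //; apply: closed_zeros1 l1.
(* The top of a chain in the section lies in a component [G i], strictly, because [l] is nonzero at
   the chosen point of [G i]; appending [G i] gives a chain in [Z] that is too long. *)
- move=> /has_irr_chainP[F [Fci FZ Flt]]; apply: nch.
  have [i FG] : exists i, F m `<=` G i.
    apply: irr_sub_union; first by case: (Fci m).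
      by move=> i; case: (GP i).
    by move=> L /FZ[/ZG].
  apply/has_irr_chainP; exists (fun j => if (j <= m)%N then F j else G i).
  have [ci ii sGi] := GP i; split=> [j _||j].
  + by case: ifP => [/Fci|_].
  + by rewrite ltnn.
  + rewrite ltnS => jm; have [jm'|mj] := ltnP j m; first by rewrite jm; apply: Flt.
    rewrite jm; have -> : j = m by apply/eqP; rewrite eqn_leq jm.
    split=> // GF.
    have [_ [L [GL vL]]] := svalP (hv i); have /eqP := lv i; apply.
    by have [_ /(_ l erefl)] := FZ L (GF L GL); apply.
exists (l :: gs); split=> /= [|g|L ZL]; first by rewrite sgs.
  by rewrite inE => /orP[/eqP -> //|/gs1].
have [lL|nlL] := pselect (zeros [set l] L); last by exists l; rewrite ?mem_head.
by have [g ggs ng] := gsZ L (conj ZL lL); exists g; rewrite // inE ggs orbT.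
Qed.

Lemma chain_le_dim Z k : has_irr_chain Z k -> (k <= n.+1)%N.
Proof.
move=> /(chain_le_size (gs := [seq 'X_i | i <- enum 'I_n.+1])).
rewrite size_map size_enum_ord; apply.
  by move=> _ /mapP[i _ ->]; apply: dhomogXi.
move=> L _; have [v v0 Lv] := proj_spaceP L; have /rV0Pn [s vs] := v0.
exists 'X_s; first by apply: map_f; rewrite mem_enum.
move=> /(_ 'X_s erefl v); rewrite Lv memv_line mevalXU => /(_ isT)/eqP.
by rewrite (negPf vs).
Qed.

Lemma proj_dimP Z : exists m, [/\ proj_dim Z = m%:Z - 1, has_irr_chain Z m
  & forall k, has_irr_chain Z k -> (k <= m)%N].
Proof.
have [m mP mmax] := @ex_maxnP (fun m => `[< has_irr_chain Z m >]) n.+1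
  (ex_intro _ 0%N (asboolT (has_irr_chain0 Z))) (fun k => @chain_le_dim Z k \o @asboolW _).
have chm : has_irr_chain Z m by apply/asboolP.
have maxm k : has_irr_chain Z k -> (k <= m)%N by move=> /asboolP; apply: mmax.
exists m; split=> //; rewrite /proj_dim.
case: xgetP => [_ -> [k [chk maxk] <-]|/(_ (m%:Z - 1))[]]; last by exists m.
by congr (_%:Z - 1); apply/eqP; rewrite eqn_leq maxm ?maxk.
Qed.

Lemma common_zero_forms (gs : seq T) : (size gs <= n)%N ->
  (forall g, g \in gs -> g \is 1.-homog) -> ~ no_common_zero gs setT.
Proof.
move=> sgs gs1 gs0.
pose M := \matrix_(i < n.+1, j < size gs) (gs`_j)@_U_(i).
have [v v0 vM] := left_kernel_exists M sgs.
have [g ggs []] := gs0 (proj_point v0) I.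
apply/(zeros1P v0 _ (gs1 g ggs)); first exact: memv_line.
rewrite (linear_form_eval _ (gs1 g ggs)).
have ig : (index g gs < size gs)%N by rewrite index_mem.
have /rowP/(_ (Ordinal ig)) := vM; rewrite !mxE => S0; rewrite -[RHS]S0.
by apply: eq_bigr => i _; rewrite mxE /= nth_index // mulrC.
Qed.

End Dimension.

(** * Eigenschemes of cubics *)

Lemma meval_mwiden (K : fieldType) (n : nat) (p : {mpoly K[n]}) (w : 'I_n.+1 -> K) :
  (mwiden p).@[w] = p.@[fun i => w (widen_ord (leqnSn n) i)].
Proof.
elim/mpolyind: p => [|c m p _ _ IH]; first by rewrite mwiden0 !meval0.
rewrite mwidenD mwidenZ mwidenX !mevalD !mevalZ IH !mevalX big_ord_recr /=.
congr (_ * _ + _); rewrite mnmwiden_ordmax expr0 mulr1.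
by apply: eq_bigr => i _; rewrite mnmwiden_widen.
Qed.

Lemma mwiden_homog (K : fieldType) (n d : nat) (p : {mpoly K[n]}) :
  p \is d.-homog -> mwiden p \is d.-homog.
Proof.
move=> pd; rewrite [p]mpolyE raddf_sum big_seq rpred_sum // => m mp /=.
rewrite mwidenZ mwidenX dhomogZ // dhomogX; apply/eqP.
have md : mdeg m = d := dhomog_mf pd mp.
rewrite -md; change (mdeg (mnmwiden m) = mdeg m).
rewrite !mdegE big_ord_recr /= mnmwiden_ordmax addn0.
by apply: eq_bigr => i _; rewrite mnmwiden_widen.
Qed.

Lemma mderiv_homog (K : fieldType) (n d : nat) (p : {mpoly K[n]}) i :
  p \is d.+1.-homog -> p^`M(i) \is d.-homog.
Proof.
move=> pd; rewrite [p]mpolyE raddf_sum big_seq rpred_sum // => m mp /=.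
have md : mdeg m = d.+1 := dhomog_mf pd mp.
rewrite mderivZ mderivX dhomogZ //; have [->|mi] := eqVneq (m i) 0%N.
  by rewrite scale0r dhomog0.
rewrite dhomogZ // dhomogX; apply/eqP.
have : mdeg (m - U_(i) + U_(i))%MM = d.+1.
  by rewrite submK // lep1mP.
by rewrite mdegD mdeg1 addn1 => -[].
Qed.

Lemma euler_identity (K : fieldType) (n d : nat) (p : {mpoly K[n]}) :
  p \is d.-homog -> \sum_i 'X_i * p^`M(i) = d%:R *: p.
Proof.
move=> pd; rewrite {2}[p]mpolyE scaler_sumr.
under eq_bigr => i _ do rewrite {1}[p]mpolyE raddf_sum mulr_sumr.
rewrite exchange_big /=; apply: eq_big_seq => m mp.
have md : mdeg m = d := dhomog_mf pd mp.
rewrite -md mdegE natr_sum scaler_suml; apply: eq_bigr => i _.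
rewrite mderivZ mderivX; have [->|mi] := eqVneq (m i) 0%N.
  by rewrite !scale0r scaler0 mulr0.
rewrite !scalerA -scalerAr -mpolyXD addmC submK ?lep1mP //.
by rewrite mulrC.
Qed.

Lemma homog_eval0 (K : numFieldType) (n d : nat) (p : {mpoly K[n]}) w :
  p \is d.+1.-homog -> (forall i, (p^`M(i)).@[w] = 0) -> p.@[w] = 0.
Proof.
move=> pd pw; have : (d.+1%:R *: p).@[w] = 0.
  by rewrite -(euler_identity pd) raddf_sum big1 // => i _ /=; rewrite mevalM pw mulr0.
by rewrite mevalZ => /eqP; rewrite mulf_eq0 pnatr_eq0 => /eqP.
Qed.

Lemma det_mx2 (A : comNzRingType) (M : 'M[A]_2) :
  \det M = M ord0 ord0 * M ord_max ord_max - M ord0 ord_max * M ord_max ord0.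
Proof.
rewrite (expand_det_row _ ord0) !big_ord_recl big_ord0 addr0 /cofactor /=.
rewrite !det_mx11 !mxE expr0 expr1 mul1r mulN1r mulrN.
by congr (_ * M _ _ - M _ _ * M _ _); apply/val_inj.
Qed.

(** * Restriction of polynomials to a parametrized line *)

Section LinePoly.
Variables (K : numFieldType) (n : nat) (y x : 'I_n -> K).
Implicit Types g : {mpoly K[n]}.

Definition line_poly g : {poly K} :=
  mmap (@polyC K) (fun i => (y i)%:P + x i *: 'X) g.

Definition dir_deriv g : {mpoly K[n]} := \sum_i x i *: g^`M(i).

Lemma line_polyD g h : line_poly (g + h) = line_poly g + line_poly h.
Proof. exact: mmapD. Qed.

Lemma line_polyM g h : line_poly (g * h) = line_poly g * line_poly h.
Proof. exact: (rmorphM (mmap (@polyC K) _)). Qed.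

Lemma line_polyXn g k : line_poly (g ^+ k) = line_poly g ^+ k.
Proof. exact: (rmorphXn (mmap (@polyC K) _)). Qed.

Lemma line_polyC c : line_poly c%:MP = c%:P.
Proof. exact: mmapC. Qed.

Lemma line_polyZ c g : line_poly (c *: g) = c *: line_poly g.
Proof. by rewrite -mul_mpolyC line_polyM line_polyC mul_polyC. Qed.

Lemma line_polyU i : line_poly 'X_i = (y i)%:P + x i *: 'X.
Proof. by rewrite /line_poly mmapX mmap1U. Qed.

Lemma mpoly_ring_ind (P : {mpoly K[n]} -> Prop) :
  (forall c, P c%:MP) -> (forall i, P 'X_i) ->
  (forall g h, P g -> P h -> P (g + h)) ->
  (forall g h, P g -> P h -> P (g * h)) -> forall g, P g.
Proof.
move=> PC PX PD PM g; elim/mpolyind: g => [|c m p _ _ IH].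
  by rewrite -(mpolyC0 n K).
apply: (PD) => //; rewrite -mul_mpolyC; apply: (PM) => //.
rewrite mpolyXE_id; apply: (big_ind P) => // [|i _].
  by rewrite -(mpolyC1 n K).
elim: (m i) => [|k IHk]; first by rewrite expr0 -(mpolyC1 n K).
by rewrite exprS; apply: PM.
Qed.

Lemma line_poly_horner g s : (line_poly g).[s] = g.@[fun i => y i + s * x i].
Proof.
elim/mpoly_ring_ind: g => [c|i|g h IHg IHh|g h IHg IHh].
- by rewrite line_polyC hornerC mevalC.
- by rewrite line_polyU !hornerE mevalXU mulrC.
- by rewrite line_polyD hornerD mevalD IHg IHh.
- by rewrite line_polyM hornerM mevalM IHg IHh.
Qed.

Lemma line_poly_deriv g : (line_poly g)^`() = line_poly (dir_deriv g).
Proof.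
elim/mpoly_ring_ind: g => [c|i|g h IHg IHh|g h IHg IHh].
- rewrite line_polyC derivC /dir_deriv big1 ?(line_polyC 0) // => i _.
  by rewrite mderivC scaler0.
- rewrite line_polyU derivD derivC derivZ derivX add0r.
  rewrite /dir_deriv (bigD1 i) //= big1 ?addr0 => [|j ji].
    rewrite mderivX mnm1E eqxx scale1r -{1}[U_(i)%MM]add0m addmK.
    by rewrite mpolyX0 line_polyZ (line_polyC 1).
  by rewrite mderivX mnm1E eq_sym (negPf ji) scale0r scaler0.
- rewrite line_polyD derivD IHg IHh -line_polyD /dir_deriv -big_split /=.
  by congr line_poly; apply: eq_bigr => i _; rewrite mderivD scalerDr.
- rewrite line_polyM derivM IHg IHh -!line_polyM -line_polyD /dir_deriv.
  rewrite mulr_suml mulr_sumr -big_split /=.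
  congr line_poly; apply: eq_bigr => i _.
  by rewrite mderivM scalerDr scalerAl scalerAr.
Qed.

End LinePoly.

Section Cubic.
Variables (R : realType) (n : nat) (f : {mpoly R[i][n.+1]}).
Local Notation C := R[i].
Local Notation T := {mpoly R[i][n.+1]}.
Hypothesis f_cubic : f \is 3.-homog.

Lemma cubic_deriv_homog i : f^`M(i) \is 2.-homog.
Proof. exact: mderiv_homog. Qed.

Lemma IrrE : Irr f = zeros (range (fun i : 'I_n.+1 => f^`M(i))).
Proof. exact: zeros_ideal_span. Qed.

Lemma Irr_closed : zariski_closed (Irr f).
Proof.
rewrite IrrE; exists (range (fun i : 'I_n.+1 => f^`M(i))); split=> //.
by move=> _ [i _ <-]; exists 2%N; apply: cubic_deriv_homog.
Qed.

Lemma Irr_point (v : 'rV[C]_n.+1) (v0 : v != 0) :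
  Irr f (proj_point v0) <-> forall i, (f^`M(i)).@[v ord0] = 0.
Proof.
have vL : v \in val (proj_point v0) by rewrite memv_line.
rewrite IrrE; split=> [Iv i|qv]; first exact: (Iv _ (imageT _ i) v).
apply/zeros_set1 => _ [i _ <-]; exact/(zeros1P v0 vL (cubic_deriv_homog i)).
Qed.

Lemma eigen_minor i j : eigen_ideal f ('X_i * f^`M(j) - 'X_j * f^`M(i)).
Proof.
apply: sub_ideal_span; exists (fun k : 'I_2 => if k == ord0 then i else j) => //.
by rewrite det_mx2 !mxE.
Qed.

Lemma sub_saturation : eigen_ideal f `<=` reg_ideal f.
Proof. by move=> p Ip; exists 0%N => h _; apply: is_idealMr => //; apply: ideal_span_ideal. Qed.

Lemma Reg_eigen L x i j : Reg f L -> x \in val L ->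
  x ord0 i * (f^`M(j)).@[x ord0] = x ord0 j * (f^`M(i)).@[x ord0].
Proof.
move=> RL xL; have := RL _ (sub_saturation (eigen_minor i j)) x xL.
by rewrite mevalB !mevalM !mevalXU => /eqP; rewrite subr_eq0 => /eqP.
Qed.

(** Some q_i is nonzero at [v]. For [p] in the saturation, p q_i^k lies in the eigen ideal, which
    vanishes along the line of [v], so [p] vanishes there too. *)
Lemma eigen_Reg (v : 'rV[C]_n.+1) (v0 : v != 0) :
  (forall i j, v ord0 i * (f^`M(j)).@[v ord0] = v ord0 j * (f^`M(i)).@[v ord0]) ->
  ~ Irr f (proj_point v0) -> Reg f (proj_point v0).
Proof.
move=> vE nI p [k pk] x xL.
have cv c : (c *: v) ord0 = fun i => c * v ord0 i.
  by apply/funext => i; rewrite mxE.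
have Ev c : eigen_ideal f `<=` [set p | p.@[(c *: v) ord0] = 0].
  apply: ideal_span_min.
    split=> [|p1 p2 /= e1 e2|a p1 /= e1]; first exact: meval0.
      by rewrite mevalD e1 e2 addr0.
    by rewrite mevalM e1 mulr0.
  move=> _ [g _ <-] /=; rewrite det_mx2 !mxE /= mevalB !mevalM !mevalXU cv.
  rewrite !(meval_scale _ _ (cubic_deriv_homog _)).
  set i := g _; set j := g _; have vEij := vE i j.
  by rewrite mulrACA vEij [X in X - _]mulrACA mulrACA subrr.
have [i qi] : exists i, (f^`M(i)).@[v ord0] != 0.
  apply: contrapT => nq; apply: nI; apply/Irr_point => i.
  by apply/eqP; apply: contraT => qi; case: nq; exists i.
have pv c : c != 0 -> p.@[(c *: v) ord0] = 0.
  move=> c0; have /pk/Ev : ideal_exp (irr_ideal f) k (f^`M(i) ^+ k).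
    apply: sub_ideal_span; exists (fun=> f^`M(i)); last first.
      by rewrite prodr_const card_ord.
    by move=> _ /=; apply: sub_ideal_span; exists i.
  move/(_ c) => /= /eqP; rewrite mevalM rmorphXn /= mulf_eq0 => /orP[/eqP //|].
  rewrite cv (meval_scale _ _ (cubic_deriv_homog i)) expf_eq0 => /andP[_].
  by rewrite mulf_eq0 expf_eq0 (negPf c0) (negPf qi).
(* The argument fails at the origin, where q_i vanishes, and [p] need not be homogeneous. The factor
   X makes the restriction vanish at 0 as well and is then cancelled. *)
have pr : 'X * line_poly (fun=> 0) (v ord0) p = 0.
  apply: poly_eq0_eval => c; rewrite hornerM hornerX line_poly_horner.
  have [->|/pv] := eqVneq c 0; first by rewrite mul0r.
  by rewrite cv; under [in X in _ -> X]eq_fun do rewrite add0r; move->; rewrite mulr0.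
move: xL => /vlineP[c ->]; have := congr1 (horner^~ c) pr => /=.
have /eqP := pr; rewrite mulf_eq0 polyX_eq0 /= => /eqP lp0.
have := line_poly_horner (fun=> 0) (v ord0) p c; rewrite lp0 horner0 cv => e _.
by rewrite [RHS]e; apply: meval_eq => j; rewrite add0r.
Qed.

(** * The lift of an irreducible part of Reg(f) to one more variable *)

Section RegDimension.
Variables (gs : seq T) (F : set (proj_space R n)) (s : 'I_n.+1).
Hypotheses (gs_lin : forall g, g \in gs -> g \is 1.-homog)
  (gs_Irr : no_common_zero gs (Irr f)).
Hypotheses (F_Reg : F `<=` Reg f) (F_irr : zariski_irreducible F)
  (F_s : ~ van F (f^`M(s))).

Local Notation widen := (widen_ord (leqnSn n.+1)).

(* The lift of F to the variety q_i(x) = t x_i in P^(n+1), with x rescaled by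
   x_s so that the last coordinate t is the quadric q_s. *)
Definition lift_point (c : C) (x : 'rV[C]_n.+1) : 'I_n.+2 -> C := fun i =>
  if unlift ord_max i is Some j then c * (x ord0 s * x ord0 j)
  else c * (f^`M(s)).@[x ord0].

Definition lifted_cone : set ('I_n.+2 -> C) :=
  [set w | exists L x c, [/\ F L, x \in val L & w = lift_point c x]].

Lemma lifted_cone_cone : is_cone lifted_cone.
Proof.
move=> _ c [L [x [d [FL xL ->]]]]; exists L, x, (c * d); split=> //.
by apply/funext => i; rewrite /lift_point; case: unlift => [j|]; ring.
Qed.

Lemma lift_point_widen c x i : lift_point c x (widen i) = c * (x ord0 s * x ord0 i).
Proof.
rewrite /lift_point (_ : widen i = lift ord_max i) ?liftK //.
by apply/val_inj; rewrite /= /bump leqNgt ltn_ord.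
Qed.

Lemma lift_point_max c x : lift_point c x ord_max = c * (f^`M(s)).@[x ord0].
Proof. by rewrite /lift_point unlift_none. Qed.

(** If x_s vanished on [F], the eigen equations x_i q_s = x_s q_i would make x_i q_s vanish for an
    x_i that does not, and hence q_s. *)
Lemma van_coord_s : ~ van F 'X_s.
Proof.
move=> /vanP vs; have [i ni] := nonempty_van_coord F_irr.1.
apply: F_s; apply: (irr_prime F_irr (dhomogXi _ _) _ ni).
apply/vanP => L x FL xL; rewrite mevalM mevalXU (Reg_eigen _ _ (F_Reg FL) xL).
by have := vs L x FL xL; rewrite mevalXU => ->; rewrite mul0r.
Qed.

(** A form h of degree d in the old variables takes the value x_s^d h(x) on the lift, and x_s is not
    a zero divisor modulo the ideal of [F]. *)
Lemma lifted_indep d k : indep_mod (van F) d k -> indep_mod (cone_ideal lifted_cone) d k.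
Proof.
move=> [u [ud uF]]; exists (fun i => mwiden (u i)); split.
  by move=> i; apply: mwiden_homog.
move=> c; pose h := \sum_i c i *: u i.
have hd : h \is d.-homog by apply: rpred_sum => i _; apply: dhomogZ.
rewrite (_ : \sum_i _ = mwiden h); last first.
  by rewrite raddf_sum; apply: eq_bigr => i _; rewrite /= mwidenZ.
move=> hW; apply: uF; rewrite -/h.
have nXd := irr_primeX (k := d) F_irr (dhomogXi R s) van_coord_s.
apply: (irr_prime F_irr (dhomogMn d (dhomogXi R s)) _ nXd).
apply/vanP => L x FL xL; rewrite mevalM rmorphXn /= mevalXU.
rewrite -(meval_scale _ _ hd).
have := hW (lift_point 1 x); rewrite meval_mwiden => <-.
  by apply: meval_eq => i; rewrite lift_point_widen mul1r.
by exists L, x, 1.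
Qed.

Lemma lifted_eqn i :
  cone_ideal lifted_cone (mwiden (f^`M(i)) - 'X_ord_max * 'X_(widen i)).
Proof.
move=> _ [L [x [c [FL xL ->]]]].
rewrite mevalB mevalM !mevalXU meval_mwiden lift_point_max lift_point_widen.
under meval_eq do rewrite lift_point_widen mulrA.
rewrite (meval_scale _ _ (cubic_deriv_homog i)) exprMn.
have := Reg_eigen s i (F_Reg FL) xL => e.
rewrite expr2 -!mulrA [x ord0 s * (f^`M(i)).@[_]]e; ring.
Qed.

Lemma chain_growth_Reg e k : (0 < e)%N ->
  (forall D, indep_mod (van F) (D * e) 'C(D + k, k)) -> (k <= size gs)%N.
Proof.
move=> e0 he; rewrite -ltnS -(size_map (@mwiden n.+1 C)).
rewrite -[X in (k < X)%N]/(size ('X_ord_max :: map (@mwiden n.+1 C) gs)).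
apply: (dim_bound (cone_ideal_ideal lifted_cone) _ _ _ e0).
- exact/cone_ideal_graded/lifted_cone_cone.
- move=> g; rewrite inE => /orP[/eqP ->|/mapP[h hgs ->]].
    exact: dhomogXi.
  by apply: mwiden_homog; apply: gs_lin.
- move=> w wW wgs.
  have wmax : w ord_max = 0.
    by have := wgs 'X_ord_max; rewrite mevalXU mem_head => ->.
  suff w0 i : w (widen i) = 0.
    move=> i; case: (unliftP ord_max i) => [j ->|-> //].
    rewrite -(w0 j); congr w; apply/val_inj.
    by rewrite /= /bump leqNgt ltn_ord.
  apply/eqP; apply: contraT => wi0.
  have v0 : \row_j w (widen j) != 0 by apply/rV0Pn; exists i; rewrite mxE.
  have [g ggs []] : exists2 g, g \in gs & ~ zeros [set g] (proj_point v0).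
    apply: gs_Irr; apply/Irr_point => j.
    rewrite row_fun_eq -meval_mwiden; have := wW _ (lifted_eqn j).
    by rewrite mevalB mevalM !mevalXU wmax mul0r subr0.
  apply/(zeros1P v0 _ (gs_lin ggs)); first exact: memv_line.
  rewrite row_fun_eq -meval_mwiden; apply: wgs.
  by rewrite inE map_f ?orbT.
- by move=> D; apply: lifted_indep.
Qed.

End RegDimension.

Lemma chain_Reg (gs : seq T) k : (forall g, g \in gs -> g \is 1.-homog) ->
  no_common_zero gs (Irr f) -> has_irr_chain (Reg f) k -> (k <= (size gs).+1)%N.
Proof.
move=> gs1 gsI; case: k => // k /has_irr_chainP[F [Fci FR Flt]].
(* The lift requires a q_s not vanishing on the top member. A top member inside Irr(f) is bounded by
   [gs] directly. *)
have [FI|nFI] := pselect (F k `<=` Irr f).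
  apply: leqW; apply: (chain_le_size gs1 gsI); apply/has_irr_chainP.
  by exists F.
have [s ns] : exists s, ~ van (F k) (f^`M(s)).
  apply: contrapT => nv; apply: nFI => L FL; rewrite IrrE.
  apply/zeros_set1 => _ [s _ <-]; apply: contrapT => nL; apply: nv; exists s.
  by move=> /van_zeros/(_ L FL).
have [e e0 he] := chain_growth Fci Flt.
by rewrite ltnS; apply: (chain_growth_Reg gs1 gsI FR _ ns e0 he); case: (Fci k).
Qed.

End Cubic.

(** * Existence of eigenvectors *)

Lemma cumulD (b b' : nat -> nat) m D :
  (iter m cumul (fun D => b D + b' D) D = iter m cumul b D + iter m cumul b' D)%N.
Proof.
elim: m D => [|m IH] D //=; rewrite /cumul -big_split /=.
by apply: eq_bigr => i _; apply: IH.
Qed.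

Lemma cumul_const m D : iter m cumul (fun=> 1%N) D = 'C(D + m, m).
Proof.
elim: m D => [|m IH] D; first by rewrite bin0.
rewrite iterS /cumul; under eq_bigr do rewrite IH.
elim: D => [|D IHD]; first by rewrite big_ord1 !add0n !binn.
by rewrite big_ord_recr /= IHD [(D.+1 + m)%N]addSnnS -binS.
Qed.

(* Sums of k+1 unit steps of length 2 cannot reach the dimension of the forms of
   degree 2D, because 2^(k+1) > 1. *)
Lemma bin_double_gt (c k : nat) : exists D,
  ('C(D + k.+1, k.+1) + c * D.+1 ^ k < 'C(D * 2 + k.+1, k.+1))%N.
Proof.
pose D := (c * k`!).+1; exists D.
have lb j : ('C(D + k.+1, k.+1) + j * 'C(D + k, k) <= 'C(D + j + k.+1, k.+1))%N.
  elim: j => [|j IH]; first by rewrite addn0 mul0n addn0.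
  rewrite [(D + j.+1)%N]addnS addSn binS mulSnr addnA leq_add //.
  by apply: leq_bin2l; rewrite addnS leqW // leq_add2r leq_addr.
have kf : (0 < k`!)%N by apply: fact_gt0.
rewrite muln2 -addnn; apply: leq_trans (lb D).
rewrite ltn_add2l -(ltn_pmul2r kf).
apply: (@leq_trans (D * D.+1 ^ k)); last by rewrite -mulnA leq_mul2l expn_le_bin orbT.
by rewrite mulnAC ltn_pmul2r ?expn_gt0.
Qed.

Lemma indep_set0 (K : fieldType) (n d : nat) :
  indep_mod [set 0 : {mpoly K[n.+1]}] d 'C(d + n, d).
Proof.
pose b := [seq s2m t | t : d.-tuple 'I_n.+1 <- enum (basis n.+1 d)].
exists (fun i => 'X_[nth 0%MM b i]); split=> [i|c /= c0 i].
  by rewrite dhomogX basis_cover mem_nth // size_basis.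
have := congr1 (mcoeff (nth 0%MM b i)) c0.
rewrite mcoeff0 raddf_sum (bigD1 i) //= mcoeffZ mcoeffX eqxx mulr1.
rewrite big1 ?addr0 // => j ji.
rewrite mcoeffZ mcoeffX nth_uniq ?size_basis ?uniq_basis //.
by rewrite (inj_eq val_inj) (negPf ji) mulr0.
Qed.

Section EigenvectorExistence.
Variables (R : realType) (n : nat) (q : 'I_n.+1 -> {mpoly R[i][n.+1]}).
Local Notation C := R[i].
Local Notation U := {mpoly R[i][n.+2]}.
Local Notation widen := (widen_ord (leqnSn n.+1)).
Local Notation t := ('X_ord_max : U).
Hypotheses (q_quadric : forall i, q i \is 2.-homog).

Definition eigen_eqn i : U := mwiden (q i) - t * 'X_(widen i).

Variable J : set U.
Hypotheses (J_ideal : is_ideal J) (J_eqn : forall i, J (eigen_eqn i)).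

Hypothesis no_eigenvector : forall w : 'I_n.+1 -> C,
  (forall i j, w i * (q j).@[w] = w j * (q i).@[w]) -> forall i, w i = 0.

(** At a common zero (x, t) of the equations x is an eigenvector unless it is 0. Hence all x_i
    vanish there, and the Nullstellensatz puts powers of them in [J]. *)
Lemma J_widen_large : exists N0, forall d (h : {mpoly C[n.+1]}),
  (N0 <= d)%N -> h \is d.-homog -> J (mwiden h).
Proof.
have [J0 JD JM] := J_ideal.
pose I : set {mpoly C[n.+1]} := [set h | J (mwiden h)].
have [||N0 hN0] := @homog_mem_ideal _ _ I; last by exists N0.
  split=> [|p s Jp Js|a p Jp].
  - by rewrite /I /= mwiden0.
  - have := JD _ _ Jp Js.
    by rewrite -mwidenD.
  - have := JM (mwiden a) _ Jp.
    by rewrite -mwidenM.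
move=> i; have [w hw|k hk] := @nullstellensatz R n.+2 (range eigen_eqn) 'X_(widen i).
  rewrite mevalXU; apply: (no_eigenvector (w := fun i => w (widen i))) => j l.
  have e m : (q m).@[fun i => w (widen i)] = w ord_max * w (widen m).
    have := hw _ (imageT eigen_eqn m).
    rewrite mevalB mevalM !mevalXU meval_mwiden => /eqP; rewrite subr_eq0.
    by move/eqP.
  by rewrite !e; ring.
exists k; rewrite /I /= rmorphXn /= mwidenX mnmwiden1.
by apply: (ideal_span_min J_ideal) hk => _ [j _ <-]; apply: J_eqn.
Qed.

(** This makes (0 : 1) a reduced point. By Euler's identity (k + 1) t h is the sum of t x_i times
    the i-th derivative of h, which modulo [J] is the sum of q_i times that derivative: a factor t
    is traded for one more degree in x, until only x is left. *)
Lemma J_mixed N0 : (forall d (h : {mpoly C[n.+1]}),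
  (N0 <= d)%N -> h \is d.-homog -> J (mwiden h)) ->
  forall b k (h : {mpoly C[n.+1]}), (N0 <= k.+1 + b)%N -> h \is k.+1.-homog ->
  J (t ^+ b * mwiden h).
Proof.
move=> hN0; have [J0 JD JM] := J_ideal; elim=> [|b IH] k h Nab ha.
  by rewrite expr0 mul1r; apply: hN0 ha; rewrite -[k.+1]addn0.
pose h' := \sum_i q i * h^`M(i).
have h'a : h' \is k.+2.-homog.
  apply: rpred_sum => i _; rewrite -[k.+2]/(2 + k)%N.
  by apply: dhomogM => //; apply: mderiv_homog.
have -> : t ^+ b.+1 * mwiden h = (k.+1%:R^-1)%:MP * (t ^+ b * mwiden h' -
    \sum_i t ^+ b * mwiden h^`M(i) * eigen_eqn i).
  have e : t * mwiden h = (k.+1%:R^-1)%:MP * \sum_i t * 'X_(widen i) * mwiden h^`M(i).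
    have := euler_identity ha => /(congr1 (@mwiden _ _)).
    rewrite mwidenZ raddf_sum /= => e.
    under eq_bigr do rewrite -mulrA; rewrite -mulr_sumr.
    rewrite (eq_bigr (fun i => mwiden ('X_i * h^`M(i)))); last first.
      by move=> i _; rewrite mwidenM mwidenX mnmwiden1.
    rewrite e mul_mpolyC -scalerAr scalerA mulVf ?scale1r //.
    by rewrite pnatr_eq0.
  rewrite exprSr -mulrA e mulrCA; congr (_ * _).
  rewrite mulr_sumr /h' raddf_sum mulr_sumr -sumrB; apply: eq_bigr => i _ /=.
  rewrite /eigen_eqn (mwidenM (q i)).
  move: (mwiden (q i)) (mwiden h^`M(i)) (t ^+ b) (t * 'X_(widen i)) => A B Tb X.
  by ring.
apply: (JM); apply: is_idealB => //.
  by apply: IH h'a; rewrite addSnnS.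
by apply: is_ideal_sum => // i _; apply: (JM); apply: J_eqn.
Qed.

Lemma J_spanned1 : exists N0, forall d, (N0 <= d)%N -> spanned_mod J d 1.
Proof.
have [J0 JD JM] := J_ideal; have [N0 hN0] := J_widen_large.
exists N0 => d Nd; exists (fun=> t ^+ d); split.
  by move=> _; have := dhomogMn d (@dhomogXi R n.+1 ord_max); rewrite mul1n.
move=> h hd; pose m0 := (U_(ord_max) *+ d)%MM : 'X_{1..n.+2}.
exists (fun=> h@_m0); rewrite big_ord1 mpolyXn -/m0.
suff mono m : mdeg m = d -> m != m0 -> J 'X_[m].
  have [hm0|hm0] := boolP (m0 \in msupp h).
    rewrite {1}[h]mpolyE (bigD1_seq m0) //= ?msupp_uniq // addrAC subrr add0r.
    rewrite big_seq_cond; apply: is_ideal_sum => // m /andP[mh mm0].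
    by apply: is_idealZ => //; apply: mono => //; apply: (dhomog_mf hd mh).
  rewrite memN_msupp_eq0 // scale0r subr0 [h]mpolyE big_seq.
  apply: is_ideal_sum => // m mh; apply: is_idealZ => //.
  apply: mono; first exact: (dhomog_mf hd mh).
  by apply: contraNneq hm0 => <-.
move=> md mm0; pose m' : 'X_{1..n.+1} := [multinom m (widen i) | i < n.+1].
have mE : 'X_[m] = t ^+ m ord_max * mwiden 'X_[m'].
  rewrite mpolyXE_id big_ord_recr /= mulrC; congr (_ * _).
  rewrite mpolyXE_id rmorph_prod; apply: eq_bigr => i _ /=.
  by rewrite rmorphXn /= mwidenX mnmwiden1 mnmE.
have dE : d = (mdeg m' + m ord_max)%N.
  rewrite -md !mdegE big_ord_recr /=; congr (_ + _)%N.
  by apply: eq_bigr => i _; rewrite mnmE.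
case m'd : (mdeg m') => [|a].
  case/eqP: mm0; apply/mnmP => i; rewrite mulmnE mnm1E.
  have m'0 : m' = 0%MM by apply/eqP; rewrite -mdeg_eq0 m'd.
  case: (unliftP ord_max i) => [j ->|->]; last by rewrite eqxx mul1n dE m'd.
  rewrite (negPf (neq_lift _ _)) mul0n.
  have /(congr1 (fun m : 'X_{1..n.+1} => m j)) := m'0.
  rewrite mnmE mnm0E => <-; congr (m _); apply/val_inj.
  by rewrite /= /bump leqNgt ltn_ord.
rewrite mE; apply: (J_mixed hN0 (k := a)); first by rewrite -m'd -dE.
by rewrite dhomogX; apply/eqP; apply: m'd.
Qed.

End EigenvectorExistence.

(** Without eigenvectors the quotient by the n + 1 quadrics has Hilbert function at most 1 in large
    degrees. Removing the quadrics bounds the forms of degree 2D in n + 2 variables by C(D+n+1, n+1)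
    plus a term of order D^n, which is too small. *)
Lemma eigenvector_exists (R : realType) (n : nat) (q : 'I_n.+1 -> {mpoly R[i][n.+1]}) :
  (forall i, q i \is 2.-homog) ->
  exists w : 'I_n.+1 -> R[i],
    (forall i j, w i * (q j).@[w] = w j * (q i).@[w]) /\ exists i, w i != 0.
Proof.
move=> q2; apply: contrapT => now.
have no_ev w : (forall i j, w i * (q j).@[w] = w j * (q i).@[w]) -> forall i, w i = 0.
  move=> wE i; apply/eqP; apply: contraT => wi; case: now.
  by exists w; split=> //; exists i.
have Z_ideal : is_ideal [set 0 : {mpoly R[i][n.+2]}].
  by split=> //= [p s -> ->|a p ->]; rewrite ?addr0 ?mulr0.
pose gs := [seq eigen_eqn q i | i <- enum 'I_n.+1].
have J_ideal := ideal_adds_ideal gs Z_ideal.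
have J_eqn i : ideal_adds [set 0] gs (eigen_eqn q i).
  by apply: mem_ideal_adds => //; apply: map_f; rewrite mem_enum.
have [N0 hN0] := J_spanned1 q2 J_ideal J_eqn no_ev.
have [k hk] := choice (fun d => spanned_all d J_ideal).
pose c := (\max_(d < N0) k (d * 2))%N.
(* The excess over 1, confined to finitely many degrees; after n + 1 summations it contributes only
   order D^n. *)
pose b D : nat := if (D < N0)%N then c else 0%N.
have hb D : spanned_mod (ideal_adds [set 0] gs) (D * 2) (1 + b D).
  rewrite /b; case: ltnP => DN.
    apply: spanned_leq (hk _); apply: leqW.
    exact: (leq_bigmax (F := fun d : 'I_N0 => k (d * 2)%N) (Ordinal DN)).
  by rewrite addn0; apply: hN0; apply: leq_trans DN _; rewrite leq_pmulr.
have gr0 : graded [set 0 : {mpoly R[i][n.+2]}] by move=> p d -> /=; rewrite pihomog0.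
have hs := spanned_adds Z_ideal gr0 (isT : (0 < 2)%N) _ hb.
have {}hs D : spanned_mod [set 0 : {mpoly R[i][n.+2]}] (D * 2) (iter n.+1 cumul (fun D => 1 + b D)%N D).
  have := hs _ D; rewrite size_map size_enum_ord; apply.
  move=> _ /mapP[i _ ->]; rewrite rpredB ?mwiden_homog //.
  by apply: (dhomogM (d := 1%N) (e := 1%N)); apply: dhomogXi.
have [D hD] := bin_double_gt (c * N0) n.
have := indep_le_spanned Z_ideal (indep_set0 _ n.+1 (D * 2)) (hs D).
rewrite cumulD cumul_const leqNgt => /negP; apply.
have -> : 'C(D * 2 + n.+1, D * 2) = 'C(D * 2 + n.+1, n.+1).
  by rewrite -(bin_sub (leq_addr _ _)) addKn.
apply: leq_ltn_trans hD; rewrite leq_add2l.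
by apply: cumul_bound => D'.
Qed.

(** * Double roots and double hyperplanes *)

Lemma meval_exp (K : fieldType) (n k : nat) (g : {mpoly K[n]}) w :
  (g ^+ k).@[w] = g.@[w] ^+ k.
Proof. exact: rmorphXn. Qed.

Lemma mpoly_eq0_eval (K : numFieldType) (n : nat) (p : {mpoly K[n]}) :
  (forall w, p.@[w] = 0) -> p = 0.
Proof.
elim: n p => [|n IH] p p0.
  by have := p0 (fun=> 0); rewrite (nvar0_mpolyC p) mevalC => ->; rewrite mpolyC0.
have [q pE] := mpoly_horner p.
suff q0 : q = 0 by rewrite pE q0 rmorph0 horner0.
apply/polyP => i; rewrite coef0; apply: IH => w.
suff : map_poly (meval w) q = 0 by move/polyP/(_ i); rewrite coef_map coef0.
apply: poly_eq0_eval => c.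
pose w' i := if unlift ord_max i is Some j then w j else c.
rewrite -[RHS](p0 w') pE (horner_coef_wide _ (size_poly _ _)).
rewrite (horner_coef_wide _ (size_poly _ _)) raddf_sum /=.
apply: eq_bigr => k _; rewrite mevalM meval_exp mevalXU /w' unlift_none !coef_map /=.
rewrite meval_mwiden; congr (_ * _); apply: meval_eq => j.
have -> : widen_ord (leqnSn n) j = lift ord_max j.
  by apply/val_inj; rewrite /= /bump leqNgt ltn_ord.
by rewrite liftK.
Qed.

Lemma mpoly_eq_eval (K : numFieldType) (n : nat) (g h : {mpoly K[n]}) :
  (forall w, g.@[w] = h.@[w]) -> g = h.
Proof.
move=> gh; apply/eqP; rewrite -subr_eq0; apply/eqP/mpoly_eq0_eval => w.
by rewrite mevalB gh subrr.
Qed.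

Lemma mpoly_neq0_eval (K : numFieldType) (n : nat) (p : {mpoly K[n]}) :
  p != 0 -> exists w, p.@[w] != 0.
Proof.
move=> p0; apply: contrapT => nw; case/eqP: p0; apply: mpoly_eq0_eval => w.
by apply/eqP; apply: contraT => pw; case: nw; exists w.
Qed.

Lemma line_poly1 (K : numFieldType) (n : nat) (y x : 'I_n -> K) (l : {mpoly K[n]}) :
  l \is 1.-homog -> line_poly y x l = l.@[y]%:P + l.@[x] *: 'X.
Proof.
move=> l1; rewrite !(linear_form_eval _ l1) {1}(linear_formE l1).
have -> : line_poly y x (\sum_i l@_U_(i) *: 'X_i) =
    \sum_i line_poly y x (l@_U_(i) *: 'X_i).
  exact: (raddf_sum (mmap (@polyC K) _)).
rewrite rmorph_sum scaler_suml -big_split /=; apply: eq_bigr => i _.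
by rewrite line_polyZ line_polyU scalerDr scalerA polyCM mul_polyC.
Qed.

Section Taylor.
Variables (K : numFieldType) (n : nat) (y x : 'I_n -> K).
Implicit Types g : {mpoly K[n]}.

Lemma dir_deriv_homog d g : g \is d.+1.-homog -> dir_deriv x g \is d.-homog.
Proof.
by move=> gd; apply: rpred_sum => i _; apply: dhomogZ; apply: mderiv_homog.
Qed.

Lemma dir_deriv_eval d g : g \is d.-homog -> (dir_deriv x g).@[x] = d%:R * g.@[x].
Proof.
move=> gd; rewrite -mevalZ -(euler_identity gd) !raddf_sum /=.
by apply: eq_bigr => i _; rewrite mevalZ mevalM mevalXU.
Qed.

Lemma poly_eq_deriv (p q : {poly K}) : p^`() = q^`() -> p.[0] = q.[0] -> p = q.
Proof.
move=> pq' pq0; apply/polyP => -[|i]; first by rewrite -!horner_coef0.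
have := congr1 (fun r : {poly K} => r`_i) pq'; rewrite !coef_deriv => /eqP.
by rewrite -subr_eq0 -mulrnBl mulrn_eq0 subr_eq0 => /eqP.
Qed.

Lemma line_poly0 g : (line_poly y x g).[0] = g.@[y].
Proof.
by rewrite line_poly_horner; apply: meval_eq => i; rewrite mul0r addr0.
Qed.

Lemma line_poly2 g : g \is 2.-homog ->
  line_poly y x g = g.@[y]%:P + (dir_deriv x g).@[y] *: 'X + g.@[x] *: 'X^2.
Proof.
move=> g2; apply: poly_eq_deriv; last by rewrite line_poly0 !hornerE ?expr0n /= ?mulr0 ?addr0.
rewrite line_poly_deriv line_poly1 ?dir_deriv_homog // (dir_deriv_eval g2).
rewrite !derivD derivC add0r !derivZ derivX derivXn alg_polyC; congr (_ + _).
by rewrite -scalerMnr mulr_natl scalerMnl.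
Qed.

Lemma line_poly3 g : g \is 3.-homog ->
  line_poly y x g = g.@[y]%:P + (dir_deriv x g).@[y] *: 'X
    + ((dir_deriv x (dir_deriv x g)).@[y] / 2) *: 'X^2 + g.@[x] *: 'X^3.
Proof.
move=> g3; apply: poly_eq_deriv; last by rewrite line_poly0 !hornerE ?expr0n /= ?mulr0 ?addr0.
rewrite line_poly_deriv line_poly2 ?dir_deriv_homog // (dir_deriv_eval g3).
rewrite !derivD derivC add0r !derivZ derivX !derivXn alg_polyC; congr (_ + _ + _).
  by rewrite -scalerMnr scalerMnl -mulr_natr divfK ?pnatr_eq0.
by rewrite -scalerMnr mulr_natl scalerMnl.
Qed.

End Taylor.

Section DoubleRoots.
Variable K : closedFieldType.

(** Three times the order of [r] at [z] is twice the order of [s], so the order of [r] is even,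
    hence at least 2. *)
Lemma root_of_cube_square (r s : {poly K}) z :
  r ^+ 3 = s ^+ 2 -> root r z -> root r^`() z.
Proof.
move=> rs /factor_theorem[r1 rE].
have lz : 'X - z%:P != 0 by rewrite polyXsubC_eq0.
have dbl (p : {poly K}) : root (p ^+ 2) z -> exists p1, p = p1 * ('X - z%:P).
  by rewrite /root horner_exp expf_eq0 /= => /factor_theorem.
have [|s1 sE] := dbl s.
  by rewrite -rs rE /root horner_exp hornerM hornerXsubC subrr mulr0 expr0n.
have s1E : r1 ^+ 3 * ('X - z%:P) = s1 ^+ 2.
  apply: (mulIf (expf_neq0 2 lz)); rewrite -exprMn -sE -rs rE exprMn.
  by rewrite -mulrA -exprS.
have [|s2 s2E] := dbl s1.
  by rewrite -s1E /root hornerM hornerXsubC subrr mulr0.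
have r1z : root r1 z.
  have : r1 ^+ 3 = s2 ^+ 2 * ('X - z%:P).
    by apply: (mulIf lz); rewrite s1E s2E exprMn [('X - _) ^+ 2]expr2 mulrA.
  move/(congr1 (horner^~ z)) => /=; rewrite horner_exp hornerM hornerXsubC.
  by rewrite subrr mulr0 => /eqP; rewrite expf_eq0.
rewrite rE /root derivM hornerD !hornerM hornerXsubC subrr mulr0 add0r.
by rewrite (eqP r1z) mul0r.
Qed.

End DoubleRoots.

Section DoubleHyperplane.
Variables (C : numClosedFieldType) (n : nat).
Local Notation T := {mpoly C[n]}.

Lemma quadric_square (Q V : T) : Q \is 2.-homog -> Q ^+ 3 = V ^+ 2 ->
  exists2 m : T, m \is 1.-homog & Q = m ^+ 2.
Proof.
move=> Q2 QV; have [->|Q0] := eqVneq Q 0.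
  by exists 0; [exact: dhomog0 | rewrite expr0n].
have [a Qa] := mpoly_neq0_eval Q0.
have s0 : sqrtC Q.@[a] != 0 by rewrite sqrtC_eq0.
(* If Q = m^2, its derivative in the direction [a] is 2 m(a) m, and m(a) is a square root of
   Q(a). *)
exists ((2 * sqrtC Q.@[a])^-1 *: dir_deriv a Q).
  by apply/dhomogZ/dir_deriv_homog.
apply: mpoly_eq_eval => y; rewrite exprZn mevalZ !meval_exp.
have rE := line_poly2 y a Q2; set r := line_poly y a Q in rE.
have rs : r ^+ 3 = line_poly y a V ^+ 2 by rewrite -!line_polyXn QV.
set D := (dir_deriv a Q).@[y] in rE *.
have [z rz] : exists z, root r z.
  apply/closed_rootP; apply/eqP => sr.
  have := congr1 (fun p : {poly C} => p`_2) rE.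
  rewrite nth_default ?sr // !coefD coefC !coefZ coefX coefXn /=.
  by rewrite mulr0 !add0r mulr1 => /eqP; rewrite eq_sym (negPf Qa).
have := root_of_cube_square rs rz; move: rz; rewrite /root rE.
rewrite !derivD derivC !derivZ derivX derivXn !hornerE /= => /eqP e1 /eqP e2.
have {}e2 : D = - (Q.@[a] * (z + z)) by apply/eqP; rewrite -addr_eq0 e2.
have {e1} -> : Q.@[y] = z ^+ 2 * Q.@[a].
  move: e1; rewrite e2 => e1; apply/eqP; rewrite -subr_eq0 -e1.
  by apply/eqP; ring.
rewrite e2; set s := sqrtC _ in s0 *.
have -> : Q.@[a] = s ^+ 2 by rewrite sqrtCK.
by clearbody s; field.
Qed.

(** At each y the values of [e2], [e1], [f] are the elementary symmetric functions of phi, phi and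
    e2 - 2 phi, so that f = phi^2 (e2 - 2 phi). It remains to show that phi is a linear form in
    y. *)
Lemma double_root_factor (f e1 e2 : T) : e1 \is 2.-homog -> e2 \is 1.-homog ->
  (forall y : 'I_n -> C, exists2 phi : C,
     e1.@[y] = 2 * phi * e2.@[y] - 3 * phi ^+ 2 &
     f.@[y] = phi * e1.@[y] - phi ^+ 2 * e2.@[y] + phi ^+ 3) ->
  exists l g : T, [/\ l \is 1.-homog, g \is 1.-homog & f = l ^+ 2 * g].
Proof.
move=> e1h e2h hphi.
(* Discriminant-type invariants of the cubic f - s e1 + s^2 e2 - s^3 in s: it has
   a double root exactly when they satisfy Q^3 = V^2, and 3 phi - e2 is then the
   common root V / Q. *)
pose Q := e2 ^+ 2 - 3 *: e1.
have Qh : Q \is 2.-homog.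
  by rewrite rpredB ?dhomogZ //; apply: (dhomogMn 2 e2h).
have QE y : Q.@[y] = e2.@[y] ^+ 2 - 3 * e1.@[y].
  by rewrite mevalB mevalZ meval_exp.
clearbody Q; pose V := 2^-1 *: (e2 ^+ 3 - 27 *: f - 3 *: (e2 * Q)).
have VE y : V.@[y] = 2^-1 * (e2.@[y] ^+ 3 - 27 * f.@[y] - 3 * (e2.@[y] * Q.@[y])).
  by rewrite mevalZ !mevalB meval_exp !mevalZ mevalM.
clearbody V.
have key (y : 'I_n -> C) : exists2 phi : C,
    f.@[y] = phi ^+ 2 * (e2.@[y] - 2 * phi) &
    (3 * phi - e2.@[y]) ^+ 2 = Q.@[y] /\ (3 * phi - e2.@[y]) ^+ 3 = V.@[y].
  have [phi e1E fE] := hphi y; exists phi; first by rewrite fE e1E; ring.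
  rewrite VE QE fE e1E; split; first by ring.
  by field.
have QV : Q ^+ 3 = V ^+ 2.
  apply: mpoly_eq_eval => y; have [phi _ [wQ wV]] := key y.
  by rewrite !meval_exp -wQ -wV -!exprM.
have [m m1 Qm] := quadric_square Qh QV.
(* V equals m^3 up to a global sign, which is absorbed into m. *)
have [m' [m'1 Qm' Vm']] : exists m' : T, [/\ m' \is 1.-homog, Q = m' ^+ 2 & V = m' ^+ 3].
  have /eqP : (V - m ^+ 3) * (V + m ^+ 3) = 0.
    by rewrite -subr_sqr -QV Qm -!exprM subrr.
  rewrite mulf_eq0 subr_eq0 addr_eq0 => /orP[/eqP Vm|/eqP Vm]; first by exists m.
  exists (- m); split; rewrite ?rpredN ?sqrrN //.
  by rewrite Vm; ring.
pose Phi := 3^-1 *: (m' + e2).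
exists Phi, (e2 - 2 *: Phi); split.
- by rewrite dhomogZ // rpredD.
- by rewrite rpredB // dhomogZ // dhomogZ // rpredD.
apply: mpoly_eq_eval => y; have [phi fE [wQ wV]] := key y.
have w : 3 * phi - e2.@[y] = m'.@[y].
  move: wQ wV; rewrite Qm' Vm' !meval_exp; set w := 3 * phi - _.
  have [->|mn0] := eqVneq m'.@[y] 0.
    by rewrite expr0n => /eqP; rewrite expf_eq0 => /eqP.
  move=> w2 w3; apply: (mulfI (expf_neq0 2 mn0)).
  by rewrite -{1}w2 -!exprSr.
rewrite mevalM meval_exp mevalB !mevalZ mevalD -w fE.
by field.
Qed.

(** The normalization makes f(y + s x) a monic cubic in s. The vanishing gradient at y - phi x says
    that -phi is a double root, and its Taylor coefficients serve as [e1] and [e2]. *)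
Lemma cubic_double_root (f : T) (x : 'I_n -> C) : f \is 3.-homog -> f.@[x] = 1 ->
  (forall y : 'I_n -> C, exists phi, forall i, (f^`M(i)).@[fun j => y j - phi * x j] = 0) ->
  exists l g : T, [/\ l \is 1.-homog, g \is 1.-homog & f = l ^+ 2 * g].
Proof.
move=> f3 fx hphi.
have e1h : dir_deriv x f \is 2.-homog by apply: dir_deriv_homog.
apply: (double_root_factor (e1 := dir_deriv x f)
  (e2 := 2^-1 *: dir_deriv x (dir_deriv x f))) => // [|y].
  by apply/dhomogZ/dir_deriv_homog.
have [phi hq] := hphi y; exists phi.
all: have zE g : g.@[fun j => y j - phi * x j] = (line_poly y x g).[- phi] by
  rewrite line_poly_horner; apply: meval_eq => j; rewrite mulNr.
  have E1 : (line_poly y x (dir_deriv x f)).[- phi] = 0.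
    rewrite -zE /dir_deriv raddf_sum big1 // => i _ /=.
    by rewrite mevalZ hq mulr0.
  move: E1; rewrite line_poly2 // (dir_deriv_eval _ f3) fx mulr1.
  rewrite !hornerD !hornerZ !hornerC !hornerX !hornerXn mevalZ => E1.
  by apply/eqP; rewrite -subr_eq0 -E1; apply/eqP; field.
have E0 : (line_poly y x f).[- phi] = 0.
  by rewrite -zE; apply: (homog_eval0 f3).
move: E0; rewrite line_poly3 // fx.
rewrite !hornerD !hornerZ !hornerC !hornerX !hornerXn mevalZ.
move: f.@[y] (dir_deriv x f).@[y] (dir_deriv x (dir_deriv x f)).@[y] => A B D.
move/eqP => E0; apply/eqP; rewrite -subr_eq0; move: E0; congr (_ == 0).
by field.
Qed.

End DoubleHyperplane.

Lemma mderiv_linear (K : fieldType) (n : nat) (l : {mpoly K[n]}) i :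
  l \is 1.-homog -> l^`M(i) = (l@_U_(i))%:MP.
Proof.
move=> l1; have l0 := mderiv_homog i l1.
rewrite [LHS]msize1_polyC; first by rewrite mcoeff_deriv add0m mnm0E mulr1n.
rewrite msizeE; apply/bigmax_leqP_seq => m ml _.
by rewrite (dhomog_mf l0 ml).
Qed.

Lemma meval_minor (K : fieldType) (n : nat) i j (p q : {mpoly K[n]}) w :
  ('X_i * p - 'X_j * q).@[w] = w i * p.@[w] - w j * q.@[w].
Proof. by rewrite mevalB !mevalM !mevalXU. Qed.

Lemma cramer2 (K : fieldType) (a1 a2 a3 b1 b2 b3 w1 w2 w3 : K) :
  a2 * b3 - a3 * b2 != 0 ->
  w1 * (a2 * b3 - a3 * b2) - w2 * (a1 * b3 - a3 * b1) + w3 * (a1 * b2 - a2 * b1) = 0 ->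
  w1 = (w2 * b3 - w3 * b2) / (a2 * b3 - a3 * b2) * a1
     + (w3 * a2 - w2 * a3) / (a2 * b3 - a3 * b2) * b1.
Proof.
move=> d0 e; apply: (mulfI d0); rewrite -[LHS]subr0 -e.
by field.
Qed.

Lemma lin_comb_neq0 (K : fieldType) (n : nat) (j k : 'I_n) (a b : 'I_n -> K) s t :
  a j * b k - a k * b j != 0 -> (s != 0) || (t != 0) ->
  exists i, s * a i + t * b i != 0.
Proof.
move=> delta0 st; apply: contrapT => ne.
have e i : s * a i + t * b i = 0.
  by apply/eqP; apply: contraT => ei; case: ne; exists i.
have s0 : s * (a j * b k - a k * b j) = 0.
  rewrite [LHS](_ : _ = b k * (s * a j + t * b j) - b j * (s * a k + t * b k)).
    by rewrite !e !mulr0 subrr.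
  by ring.
have t0 : t * (a j * b k - a k * b j) = 0.
  rewrite [LHS](_ : _ = a j * (s * a k + t * b k) - a k * (s * a j + t * b j)).
    by rewrite !e !mulr0 subrr.
  by ring.
move/eqP: s0; move/eqP: t0; move: st; rewrite !mulf_eq0 (negPf delta0) !orbF.
by case/orP => /negP.
Qed.

Lemma colinear_pairs (K : fieldType) (u v : K) (s t : K) : (u != 0) || (v != 0) -> s * v = t * u ->
  exists c, s = c * u /\ t = c * v.
Proof.
have [-> /= v0|u0 _] := eqVneq u 0; move=> e.
  exists (t / v); rewrite divfK // mulr0; split=> //.
  by apply/eqP; move/eqP: e; rewrite mulr0 mulf_eq0 (negPf v0) orbF.
by exists (s / u); rewrite divfK //; split=> //; rewrite mulrAC e mulfK.
Qed.

Section GradFactor.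
Variables (K : numFieldType) (n : nat) (l g : {mpoly K[n]}).

Definition grad_factor i : {mpoly K[n]} :=
  2 * (l@_U_(i))%:MP * g + (g@_U_(i))%:MP * l.

Lemma mderiv_sqr_mul i : l \is 1.-homog -> g \is 1.-homog ->
  (l ^+ 2 * g)^`M(i) = l * grad_factor i.
Proof.
move=> l1 g1; rewrite expr2 !mderivM (mderiv_linear _ l1) (mderiv_linear _ g1).
by rewrite /grad_factor; ring.
Qed.

Lemma grad_factor_eval i w :
  (grad_factor i).@[w] = 2 * l@_U_(i) * g.@[w] + g@_U_(i) * l.@[w].
Proof. by rewrite mevalD !mevalM !mevalC rmorph_nat. Qed.

Lemma grad_factor_minor_eval i j w :
  ('X_i * grad_factor j - 'X_j * grad_factor i).@[w] =
  w i * (2 * l@_U_(j) * g.@[w] + g@_U_(j) * l.@[w])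
  - w j * (2 * l@_U_(i) * g.@[w] + g@_U_(i) * l.@[w]).
Proof. by rewrite meval_minor; congr (_ * _ - _ * _); apply: grad_factor_eval. Qed.

Lemma grad_factor_colinear c i :
  (forall i, g@_U_(i) = c * l@_U_(i)) -> l \is 1.-homog -> g \is 1.-homog ->
  grad_factor i = (3 * c * l@_U_(i)) *: l.
Proof.
move=> gl l1 g1; have gE : g = c *: l.
  rewrite (linear_formE g1) [in RHS](linear_formE l1) scaler_sumr.
  by apply: eq_bigr => j _; rewrite gl scalerA.
apply: mpoly_eq_eval => w; rewrite grad_factor_eval mevalZ gl gE mevalZ.
by ring.
Qed.

(* Points of the plane spanned by the gradients a and b of l and g where the
   vector 2 g a + l b is parallel to the position vector s a + t b satisfy a
   quadratic equation in (s : t). *)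
Lemma plane_section (j k : 'I_n) (a := fun i => l@_U_(i)) (b := fun i => g@_U_(i))
    (delta := a j * b k - a k * b j)
    (aa := \sum_i a i * a i) (ab := \sum_i b i * a i) (bb := \sum_i b i * b i) w :
  l \is 1.-homog -> g \is 1.-homog -> delta != 0 ->
  (forall i, w i * delta - w j * (a i * b k - a k * b i)
     + w k * (a i * b j - a j * b i) = 0) ->
  w j * (2 * a k * g.@[w] + b k * l.@[w]) = w k * (2 * a j * g.@[w] + b j * l.@[w]) ->
  exists s t, (forall i, w i = s * a i + t * b i) /\
    aa * s ^+ 2 + (- ab) * (s * t) + (- 2 * bb) * t ^+ 2 = 0.
Proof.
move=> l1 g1 delta0 we wm.
pose s := (w j * b k - w k * b j) / delta; pose t := (w k * a j - w j * a k) / delta.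
have wE i : w i = s * a i + t * b i by apply: cramer2.
have lw : l.@[w] = s * aa + t * ab.
  rewrite (linear_form_eval _ l1) !mulr_sumr -big_split /=.
  by apply: eq_bigr => i _; rewrite wE /a; ring.
have gw : g.@[w] = s * ab + t * bb.
  rewrite (linear_form_eval _ g1) !mulr_sumr -big_split /=.
  by apply: eq_bigr => i _; rewrite wE /b; ring.
exists s, t; split=> //; apply: (mulfI delta0); rewrite mulr0.
move/eqP: wm; rewrite lw gw -subr_eq0 => /eqP <-; rewrite !wE /delta.
by ring.
Qed.

End GradFactor.

(** * Missed points, whole space and hyperplanes *)

Section Hyperplanes.
Variables (R : realType) (n : nat).
Local Notation C := R[i].
Local Notation T := {mpoly R[i][n.+1]}.
Local Notation PS := (proj_space R n).
Implicit Types (Z : set PS) (L : PS) (l g : T).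

Lemma forms_cutting k (M : 'M[C]_(k, n.+1)) : exists gs : seq T,
  [/\ size gs = (n.+1 - \rank M)%N, forall g, g \in gs -> g \is 1.-homog &
      forall w : 'rV_n.+1, (forall g, g \in gs -> g.@[w ord0] = 0) -> (w <= M)%MS].
Proof.
pose B := col_base (cokermx M); pose h j : T := \sum_i B i j *: 'X_i.
exists [seq h j | j <- enum 'I_(\rank (cokermx M))]; split.
- by rewrite size_map size_enum_ord mxrank_coker.
- move=> _ /mapP[j _ ->]; apply: rpred_sum => i _.
  by apply/dhomogZ/dhomogXi.
move=> w hw; rewrite submxE -(mulmx_base (cokermx M)) mulmxA.
suff -> : w *m B = 0 by rewrite mul0mx.
apply/rowP => j; rewrite !mxE -[RHS](hw (h j)); last by apply: map_f; rewrite mem_enum.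
rewrite raddf_sum; apply: eq_bigr => i _ /=.
by rewrite mevalZ mevalXU mulrC.
Qed.

Lemma no_common_zeroPn (gs : seq T) Z : ~ no_common_zero gs Z ->
  exists (w : 'rV[C]_n.+1) (w0 : w != 0), Z (proj_point w0) /\
    forall g, g \in gs -> g.@[w ord0] = 0.
Proof.
move=> ncz; apply: contrapT => nw; apply: ncz => L ZL.
have [w w0 Lw] := proj_spaceP L.
apply: contrapT => ng; apply: nw; exists w, w0; split=> [|g ggs].
  by rewrite (_ : proj_point w0 = L) //; apply/val_inj.
have gL : zeros [set g] L by apply: contrapT => gL; apply: ng; exists g.
by apply: (gL g erefl); rewrite Lw memv_line.
Qed.

Lemma proj_point_eq L (v w : 'rV[C]_n.+1) (w0 : w != 0) c :
  v != 0 -> val L = <[v]>%VS -> v = c *: w -> L = proj_point w0.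
Proof.
move=> v0 Lv vw; apply/val_inj; rewrite Lv /=.
apply/eqP; rewrite eqEdim !dim_vline v0 w0 leqnn andbT -memvE vw.
exact: memvZ (memv_line _).
Qed.

(** Projection from the missed point: the n linear forms vanishing there have no common zero on
    [Z]. *)
Lemma chain_notin Z L k : ~ Z L -> has_irr_chain Z k -> (k <= n)%N.
Proof.
move=> nZL; have [x x0 Lx] := proj_spaceP L.
have [gs [sgs gs1 gsx]] := forms_cutting x.
rewrite rank_rV x0 subn1 /= in sgs.
suff : has_irr_chain Z k -> (k <= size gs)%N by rewrite sgs.
apply: chain_le_size => //.
apply: contrapT => /no_common_zeroPn[w [w0 [Zw /gsx/sub_rVP[a wx]]]].
apply: nZL; rewrite (proj_point_eq (c := a^-1) w0 x0 Lx) //.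
rewrite wx scalerA mulVf ?scale1r //.
by apply: contraNneq (w0) => a0; rewrite wx a0 scale0r.
Qed.

Lemma has_chain_forms Z m : zariski_closed Z ->
  (forall gs : seq T, size gs = m -> (forall g, g \in gs -> g \is 1.-homog) ->
     ~ no_common_zero gs Z) -> has_irr_chain Z m.+1.
Proof.
move=> cZ hgs; apply: contrapT => /(no_chain_forms cZ)[gs [sgs gs1]].
exact: hgs.
Qed.

Lemma setT_closed : zariski_closed [set: PS].
by exists set0; split=> //; apply/seteqP; split=> // L _ g [].
Qed.

Lemma setT_chain : has_irr_chain [set: PS] n.+1.
Proof.
apply: has_chain_forms; first exact: setT_closed.
by move=> gs sgs; apply: common_zero_forms; rewrite sgs.
Qed.

Lemma linear_form_nonzero l : is_linear_form l -> exists x : 'rV[C]_n.+1, l.@[x ord0] != 0.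
Proof.
case=> l1 /mpoly_neq0_eval[w lw].
by exists (\row_i w i); rewrite row_fun_eq.
Qed.

Lemma hyperplane_dim Z : is_hyperplane Z -> proj_dim Z = n%:Z - 1.
Proof.
case=> l ll ->; have [l1 l0] := ll; have [m [-> chm maxm]] := proj_dimP (zeros [set l]).
congr (_%:Z - 1); apply/eqP; rewrite eqn_leq; apply/andP; split.
  have [x lx] := linear_form_nonzero ll.
  have x0 : x != 0.
    apply: contraNneq lx => ->; rewrite (linear_form_eval _ l1) big1 // => i _.
    by rewrite mxE mulr0.
  apply: (chain_notin (L := proj_point x0)) chm => /(_ l erefl x).
  by rewrite memv_line => /(_ isT)/eqP; rewrite (negPf lx).
apply: maxm; have [n0|n_gt0] := posnP n.
  by apply: has_irr_chain_leq (has_irr_chain0 _); rewrite n0.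
have := @has_chain_forms (zeros [set l]) n.-1; rewrite prednK //; apply.
  exact: closed_zeros1 l1.
move=> gs sgs gs1 gsl; apply: (@common_zero_forms R n (l :: gs)).
- by rewrite /= sgs prednK.
- by move=> g; rewrite inE => /orP[/eqP ->|/gs1].
move=> L _; have [lL|nlL] := pselect (zeros [set l] L).
  by have [g ggs ng] := gsl L lL; exists g; rewrite // inE ggs orbT.
by exists l; rewrite ?mem_head.
Qed.

End Hyperplanes.

Section DoubleHyperplaneCubic.
Variables (R : realType) (n : nat) (f : {mpoly R[i][n.+1]}).
Local Notation C := R[i].
Local Notation T := {mpoly R[i][n.+1]}.
Hypotheses (f_cubic : f \is 3.-homog) (f_neq0 : f != 0).

Lemma chain_double_hyperplane : has_irr_chain (Irr f) n ->
  exists l g : T, [/\ l \is 1.-homog, g \is 1.-homog & f = l ^+ 2 * g].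
Proof.
move=> chI.
have [x fx] := mpoly_neq0_eval f_neq0.
have [|||l [g [l1 g1 fE]]] := @cubic_double_root R[i] n.+1 (f.@[x]^-1 *: f) x.
- exact: dhomogZ.
- by rewrite mevalZ mulVf.
- move=> y; pose X : 'rV[C]_n.+1 := \row_i x i; pose Y : 'rV[C]_n.+1 := \row_i y i.
  have q0 i (w : 'I_n.+1 -> C) c : (f^`M(i)).@[fun j => c * w j] = c ^+ 2 * (f^`M(i)).@[w].
    exact/meval_scale/cubic_deriv_homog.
  suff [phi hphi] : exists phi, forall i, (f^`M(i)).@[fun j => y j - phi * x j] = 0.
    by exists phi => i; rewrite mderivZ mevalZ hphi mulr0.
  (* If y is a multiple of x, the double root moves y to the origin, where the quadrics vanish. *)
  have [/sub_rVP[a Ya]|nYX] := boolP (Y <= X)%MS.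
    exists a => i; rewrite (meval_eq (v2 := fun j => 0 * x j)).
      by rewrite q0 expr0n mul0r.
    by move=> j; have /rowP/(_ j) := Ya; rewrite !mxE => ->; rewrite subrr mul0r.
  have [gs [sgs gs1 gsM]] := forms_cutting (col_mx Y X).
  have rk : \rank (col_mx Y X) = 2%N.
    have X0 : X != 0.
      apply: contraNneq fx => X0; rewrite (meval_eq (v2 := fun j => 0 * x j)).
        by rewrite (meval_scale _ _ f_cubic) expr0n mul0r.
      by move=> j; have /rowP/(_ j) := X0; rewrite !mxE mul0r.
    apply/eqP; rewrite eqn_leq rank_leq_row /= ltnNge; apply/negP => rk1.
    case/negP: nYX; have XM : (X <= col_mx Y X)%MS by rewrite -addsmxE addsmxSr.
    have := mxrank_leqif_eq XM; rewrite rank_rV X0 => -[rk2 rkE].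
    have MX : (col_mx Y X <= X)%MS.
      by have := rkE; rewrite eqn_leq rk1 rk2 => /esym/andP[].
    by apply: submx_trans MX; rewrite -addsmxE addsmxSl.
  have n0 : (0 < n)%N by have := rank_leq_col (col_mx Y X); rewrite rk.
  rewrite rk subSS in sgs.
  (* The n - 1 forms cutting out the line through x and y must have a common zero on Irr(f), by the
     length of the chain. *)
  have [|w [w0 [Iw gw]]] := @no_common_zeroPn R n gs (Irr f).
    move=> gsI; have := chain_le_size gs1 gsI chI.
    by rewrite sgs; case: (n) n0 => // n' _; rewrite subn1 ltnn.
  have {}Iw := (Irr_point f_cubic w0).1 Iw.
  have /gsM := gw; rewrite -addsmxE => /sub_addsmxP[[u1 u2] /= wE].
  pose a := u1 0 0; pose b := u2 0 0.
  have wE' j : w ord0 j = a * y j + b * x j.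
    by rewrite wE !mxE !big_ord1 !mxE.
  (* The zero found is not x itself: f vanishes on Irr(f) by Euler's identity, but not at x. *)
  have a0 : a != 0.
    apply/eqP => a0; case/eqP: w0.
    have := homog_eval0 f_cubic Iw; rewrite (meval_eq (v2 := fun j => b * x j)); last first.
      by move=> j; rewrite wE' a0 mul0r add0r.
    rewrite (meval_scale _ _ f_cubic) => /eqP.
    rewrite mulf_eq0 (negPf fx) orbF expf_eq0 /= => /eqP b0.
    by apply/rowP => j; rewrite wE' a0 b0 !mul0r addr0 mxE.
  exists (- (b / a)) => i; rewrite (meval_eq (v2 := fun j => a^-1 * w ord0 j)).
    by rewrite q0 Iw mulr0.
  by move=> j; rewrite wE'; field.
exists l, (f.@[x] *: g); split; [by []|exact: dhomogZ|].
by rewrite -scalerAr -fE scalerA mulfV // scale1r.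
Qed.

Variables l g : T.
Hypotheses (l_lin : l \is 1.-homog) (g_lin : g \is 1.-homog) (fE : f = l ^+ 2 * g).
Local Notation a i := (l@_U_(i)).
Local Notation b i := (g@_U_(i)).

Lemma double_hyperplane_deriv i : f^`M(i) = l * grad_factor l g i.
Proof. by rewrite fE mderiv_sqr_mul. Qed.

Lemma l_neq0 : l != 0.
Proof. by apply: contraNneq f_neq0 => l0; rewrite fE l0 expr0n mul0r. Qed.

Lemma g_neq0 : g != 0.
Proof. by apply: contraNneq f_neq0 => g0; rewrite fE g0 mulr0. Qed.

(** Where l is nonzero, the vector 2 g grad l + l grad g must vanish. Pairing it with the point
    gives 3 l g = 0, so g = 0 there; then grad g = 0, against g being nonzero. *)
Lemma Irr_double_hyperplane : Irr f = zeros [set l].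
Proof.
apply/seteqP; split=> L; have [v v0 Lv] := proj_spaceP L;
  have vL : v \in val L by rewrite Lv memv_line.
  rewrite IrrE => IL; apply/(zeros1P v0 vL l_lin).
  apply/eqP; apply: contraT => lv.
  have q0 i : 2 * a i * g.@[v ord0] + b i * l.@[v ord0] = 0.
    have := IL _ (imageT _ i) v vL; rewrite double_hyperplane_deriv mevalM.
    by rewrite grad_factor_eval => /eqP; rewrite mulf_eq0 (negPf lv) => /eqP.
  have gv : g.@[v ord0] = 0.
    have : \sum_i (2 * a i * g.@[v ord0] + b i * l.@[v ord0]) * v ord0 i = 0.
      by rewrite big1 // => i _; rewrite q0 mul0r.
    rewrite (eq_bigr (fun i => 2 * g.@[v ord0] * (a i * v ord0 i)
      + l.@[v ord0] * (b i * v ord0 i))); last by move=> i _; ring.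
    rewrite big_split /= -!mulr_sumr -!linear_form_eval //.
    move/eqP; rewrite [l.@[_] * _]mulrC -mulrDl mulf_eq0 (negPf lv) orbF.
    rewrite -[X in _ + X]mul1r -mulrDl mulf_eq0 => /orP[|/eqP //].
    by rewrite -(natrD _ 2 1) pnatr_eq0.
  case/eqP: g_neq0; rewrite (linear_formE g_lin) big1 // => i _.
  have /eqP := q0 i; rewrite gv mulr0 add0r mulf_eq0 (negPf lv) orbF => /eqP ->.
  by rewrite scale0r.
move=> /(zeros1P v0 vL l_lin) lv; rewrite IrrE; apply/zeros_set1 => _ [i _ <-].
apply/(zeros1P v0 vL (cubic_deriv_homog f_cubic i)).
by rewrite double_hyperplane_deriv mevalM lv mul0r.
Qed.

End DoubleHyperplaneCubic.

(** * Regular eigenpoints of a double hyperplane *)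

Lemma card_sub_pair (T : choiceType) (Z : set T) (P1 P2 : T) : Z `<=` [set P1; P2] ->
  (Z #= `I_0 \/ Z #= `I_1 \/ Z #= `I_2)%card.
Proof.
move=> Z12; pose h (L : T) : nat := if L == P1 then 0%N else 1%N.
have hinj : {in Z &, injective h}.
  move=> x y; rewrite !inE /h => /Z12[->|->] /Z12[->|->] //; rewrite ?eqxx;
    by case: eqP => // ->.
have hZ : h @` Z `<=` `I_2 by move=> _ [x _ <-]; rewrite /h /=; case: ifP.
have hcard := inj_card_eq hinj.
have /finite_setP[k hk] : finite_set (h @` Z) by apply: sub_finite_set hZ _; apply: finite_II.
have Zk : (Z #= `I_k)%card by apply: card_eq_trans hk; apply: card_esym.
have : (`I_k #<= `I_2)%card.
  by rewrite -(card_le_eql hk); apply: subset_card_le.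
rewrite card_le_II; case: k Zk {hk} => [|[|[|k]]] // Zk _; [left|right; left|right; right] => //.
Qed.

Lemma binary_quadratic_zeros (K : numClosedFieldType) (al be ga : K) :
  [|| al != 0, be != 0 | ga != 0] ->
  exists s1 t1 s2 t2 : K, [/\ (s1 != 0) || (t1 != 0), (s2 != 0) || (t2 != 0) &
    forall s t, al * s ^+ 2 + be * (s * t) + ga * t ^+ 2 = 0 ->
      s * t1 = t * s1 \/ s * t2 = t * s2].
Proof.
have [-> | al0 _] := eqVneq al 0.
  (* The form is t (be s + ga t), with the zeros (1 : 0) and (ga : -be). *)
  rewrite /= => bega; exists 1, 0, ga, (- be).
  split=> [||s t e]; [by rewrite oner_eq0|by rewrite oppr_eq0 orbC|].
  have /eqP : t * (s * be + ga * t) = 0 by rewrite -e; ring.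
  rewrite mulf_eq0 => /orP[/eqP ->|/eqP e2]; first by left; rewrite mulr0 mul0r.
  by right; apply/eqP; rewrite -subr_eq0 -oppr_eq0 -e2; apply/eqP; ring.
pose d := sqrtC (be ^+ 2 - 4 * al * ga).
have dE : d ^+ 2 = be ^+ 2 - 4 * al * ga by rewrite sqrtCK.
exists (- be + d), (2 * al), (- be - d), (2 * al).
have a2 : 2 * al != 0 by rewrite mulf_neq0 // pnatr_eq0.
rewrite a2 !orbT; split=> // s t e.
have /eqP : (s * (2 * al) - t * (- be + d)) * (s * (2 * al) - t * (- be - d)) = 0.
  rewrite [LHS](_ : _ = 4 * al * (al * s ^+ 2 + be * (s * t) + ga * t ^+ 2)
     + t ^+ 2 * (be ^+ 2 - 4 * al * ga - d ^+ 2)); last by ring.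
  by rewrite e dE subrr !mulr0 addr0.
by rewrite mulf_eq0 !subr_eq0 => /orP[/eqP|/eqP]; [left|right].
Qed.

Lemma scaled_minor (K : fieldType) (n : nat) (x y l : {mpoly K[n]}) (c p q : K) :
  (x * ((c * p) *: l) - y * ((c * q) *: l)) * l =
  c *: (x * p%:MP - y * q%:MP) * l * l.
Proof. by rewrite -!mul_mpolyC !mpolyCM; ring. Qed.

(** Coordinates of x /\ (2 g a + l b) /\ a = l x /\ b /\ a, which expresses l times the trivector
    through the minors of x and 2 g a + l b. The second [l] is the factor these minors carry in the
    eigen ideal. *)
Lemma wedge_identity (A : comNzRingType) (x y z l g a1 a2 a3 b1 b2 b3 : A) :
  (x * (a2 * b3 - a3 * b2) - y * (a1 * b3 - a3 * b1) + z * (a1 * b2 - a2 * b1)) * l * l =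
  a2 * ((x * (2 * a3 * g + b3 * l) - z * (2 * a1 * g + b1 * l)) * l)
  - a3 * ((x * (2 * a2 * g + b2 * l) - y * (2 * a1 * g + b1 * l)) * l)
  - a1 * ((y * (2 * a3 * g + b3 * l) - z * (2 * a2 * g + b2 * l)) * l).
Proof. by ring. Qed.

Lemma wedge_eval (K : fieldType) (n : nat) (i j k : 'I_n) (a1 a2 a3 b1 b2 b3 : K) w :
  ('X_i * (a2%:MP * b3%:MP - a3%:MP * b2%:MP) - 'X_j * (a1%:MP * b3%:MP - a3%:MP * b1%:MP)
   + 'X_k * (a1%:MP * b2%:MP - a2%:MP * b1%:MP)).@[w] =
  w i * (a2 * b3 - a3 * b2) - w j * (a1 * b3 - a3 * b1) + w k * (a1 * b2 - a2 * b1).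
Proof. by rewrite -!mpolyCM -!mpolyCB mevalD mevalB !mevalM !mevalXU !mevalC. Qed.

Lemma isotropic_contraction (K : fieldType) (n : nat) (a b w : 'I_n -> K) (j k : 'I_n) :
  \sum_i a i * a i = 0 -> \sum_i b i * a i = 0 ->
  (a j * b k - a k * b j) * \sum_i a i * w i =
  \sum_i a i * (w i * (a j * b k - a k * b j) - w j * (a i * b k - a k * b i)
    + w k * (a i * b j - a j * b i)).
Proof.
move=> aa0 ab0; rewrite [RHS](eq_bigr (fun i => (a j * b k - a k * b j) * (a i * w i)
    + (w k * b j - w j * b k) * (a i * a i)
    + (w j * a k - w k * a j) * (b i * a i))); last by move=> i _; ring.
by rewrite !big_split /= -!mulr_sumr aa0 ab0 !mulr0 !addr0.
Qed.

Section RegPoints.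
Variables (R : realType) (n : nat) (f l g : {mpoly R[i][n.+1]}).
Local Notation C := R[i].
Local Notation T := {mpoly R[i][n.+1]}.
Hypotheses (f_cubic : f \is 3.-homog) (f_neq0 : f != 0).
Hypotheses (l_lin : l \is 1.-homog) (g_lin : g \is 1.-homog) (fE : f = l ^+ 2 * g).
Local Notation a i := (l@_U_(i)).
Local Notation b i := (g@_U_(i)).

Let I_ideal : is_ideal (eigen_ideal f). Proof. exact: ideal_span_ideal. Qed.

(** Every element of the irregular ideal is a multiple of [l]; one additional factor from that ideal
    therefore supplies the missing [l], at the cost of raising the exponent by one. *)
Lemma reg_ideal_div p : reg_ideal f (p * l) -> reg_ideal f p.
Proof.
have [I0 ID IM] := I_ideal.
case=> k hk; exists k.+1; apply: ideal_span_min.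
  split=> /= [|h1 h2 H1 H2|c h H]; first by rewrite mulr0.
    by rewrite mulrDr; apply: ID.
  by rewrite mulrCA; apply: IM.
move=> _ [t tJ <-]; rewrite big_ord_recl.
have [u tu] : exists u, t ord0 = l * u.
  move: (tJ ord0); apply: (ideal_span_min (I := [set p | exists u, p = l * u])).
    split=> /= [|_ _ [u1 ->] [u2 ->]|c _ [u ->]]; first by exists 0; rewrite mulr0.
      by exists (u1 + u2); rewrite mulrDr.
    by exists (c * u); rewrite mulrCA.
  move=> _ [i _ <-]; exists (grad_factor l g i).
  exact: double_hyperplane_deriv.
rewrite tu /= [X in eigen_ideal f X](_ : _ = u * (p * l * \prod_(i < k) t (lift ord0 i))); last by ring.
apply: IM; apply: hk; apply: sub_ideal_span.
by exists (fun i => t (lift ord0 i)) => // i /=; apply: tJ.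
Qed.

Lemma reg_ideal_div2 c p : c != 0 -> eigen_ideal f (c *: p * l * l) -> reg_ideal f p.
Proof.
move=> c0 Ip; do 2 apply: reg_ideal_div; apply: sub_saturation.
rewrite -(scalerK c0 p) -!scalerAl.
by apply: is_idealZ => //; rewrite !scalerAl.
Qed.

Lemma eigen_minor_factor i j : eigen_ideal f
  (('X_i * grad_factor l g j - 'X_j * grad_factor l g i) * l).
Proof.
have := eigen_minor f i j; rewrite !(double_hyperplane_deriv l_lin g_lin fE).
congr (eigen_ideal f _).
move: (grad_factor l g j) (grad_factor l g i) ('X_i : T) ('X_j : T) => A B x y.
by ring.
Qed.

Lemma Reg_minor_factor L v i j : Reg f L -> v \in val L ->
  v ord0 i * (2 * a j * g.@[v ord0] + b j * l.@[v ord0]) =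
  v ord0 j * (2 * a i * g.@[v ord0] + b i * l.@[v ord0]).
Proof.
move=> RL vL.
have := RL _ (reg_ideal_div (sub_saturation (eigen_minor_factor i j))) v vL.
by rewrite grad_factor_minor_eval => /eqP; rewrite subr_eq0 => /eqP.
Qed.

(** Here g = c l, so the gradient of f is 3 c l^2 grad l. After l is cancelled, the minors force a
    point of Reg(f) to be parallel to grad l. *)
Lemma Reg_dependent : (forall j k, a j * b k = a k * b j) ->
  exists P, Reg f `<=` [set P].
Proof.
move=> ab; have [s as0] : exists s, a s != 0.
  apply: contrapT => na; case/eqP: (l_neq0 f_neq0 fE).
  rewrite (linear_formE l_lin) big1 // => i _.
  have [->|ai] := eqVneq (a i) 0; first by rewrite scale0r.
  by case: na; exists i.
pose c := b s / a s.
have bE i : b i = c * a i by rewrite /c mulrAC [b s * _]mulrC ab [a s * _]mulrC mulfK.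
have c0 : c != 0.
  apply: contraNneq (g_neq0 f_neq0 fE) => c0; rewrite (linear_formE g_lin) big1 // => i _.
  by rewrite bE c0 mul0r scale0r.
have A0 : \row_i a i != 0 by apply/rV0Pn; exists s; rewrite mxE.
exists (proj_point A0) => L RL; have [v v0 Lv] := proj_spaceP L.
have vL : v \in val L by rewrite Lv memv_line.
have va i : v ord0 i * a s = v ord0 s * a i.
  have /RL/(_ v vL) : reg_ideal f ('X_i * (a s)%:MP - 'X_s * (a i)%:MP).
    apply: (@reg_ideal_div2 (3 * c)); first by rewrite mulf_neq0 // pnatr_eq0.
    have := eigen_minor_factor i s.
    by rewrite !(grad_factor_colinear _ bE l_lin g_lin) scaled_minor.
  by rewrite meval_minor !mevalC => /eqP; rewrite subr_eq0 => /eqP.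
apply: (proj_point_eq (c := v ord0 s / a s) A0 v0 Lv).
by apply/rowP => j; rewrite !mxE mulrAC -va mulfK.
Qed.

Section Independent.
Variables j k : 'I_n.+1.
Hypothesis delta0 : a j * b k - a k * b j != 0.
Local Notation A i := ((a i)%:MP : T).
Local Notation B i := ((b i)%:MP : T).

(* The coefficient at (i, j, k) of the trivector x /\ grad l /\ grad g. *)
Definition trivector_coef i : T :=
  'X_i * (A j * B k - A k * B j) - 'X_j * (A i * B k - A k * B i)
  + 'X_k * (A i * B j - A j * B i).

Lemma trivector_coef_eval i w : (trivector_coef i).@[w] =
  w i * (a j * b k - a k * b j) - w j * (a i * b k - a k * b i)
  + w k * (a i * b j - a j * b i).
Proof. exact: wedge_eval. Qed.

Lemma trivector_coef_eigen i : eigen_ideal f (trivector_coef i * l * l).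
Proof.
have [I0 ID IM] := I_ideal.
rewrite /trivector_coef (wedge_identity _ _ _ l g).
by apply: (is_idealB I_ideal); [apply: (is_idealB I_ideal)|]; apply: (IM);
  exact: eigen_minor_factor.
Qed.

Lemma trivector_coef_reg i : reg_ideal f (trivector_coef i).
Proof. by do 2 apply: reg_ideal_div; apply: sub_saturation; apply: trivector_coef_eigen. Qed.

(* When grad l and grad g span a totally isotropic plane, contracting the
   trivector with grad l leaves a nonzero multiple of l. *)
Lemma Reg_isotropic : \sum_i a i * a i = 0 -> \sum_i b i * a i = 0 -> Reg f = set0.
Proof.
move=> aa0 ab0; apply/seteqP; split=> // L RL.
have reg1 : reg_ideal f 1.
  apply: reg_ideal_div; apply: (reg_ideal_div2 delta0).
  rewrite (_ : _ *: (1 * l) = \sum_i (a i)%:MP * trivector_coef i).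
    rewrite !mulr_suml; apply: is_ideal_sum => // i _.
    rewrite -!mulrA; case: I_ideal => _ _; apply; rewrite mulrA.
    exact: trivector_coef_eigen.
  rewrite mul1r; apply: mpoly_eq_eval => w; rewrite mevalZ raddf_sum /=.
  under eq_bigr do rewrite mevalM mevalC trivector_coef_eval.
  by rewrite (linear_form_eval _ l_lin); apply: isotropic_contraction.
have [v v0 Lv] := proj_spaceP L.
have := RL 1 reg1 v; rewrite Lv memv_line meval1 => /(_ isT)/eqP.
by rewrite oner_eq0.
Qed.

Lemma Reg_independent : exists P1 P2, Reg f `<=` [set P1; P2].
Proof.
pose lin s t : 'rV[C]_n.+1 := \row_i (s * a i + t * b i).
have lin0 s t : (s != 0) || (t != 0) -> lin s t != 0.
  move=> st; apply/rV0Pn; have [i ei] := @lin_comb_neq0 _ _ j k (fun i => a i) (fun i => b i) s t delta0 st.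
  by exists i; rewrite mxE.
have [nz|/norP[/negbNE/eqP aa0 /norP[/negbNE/eqP ab0 _]]] :=
    boolP [|| \sum_i a i * a i != 0, \sum_i b i * a i != 0 | \sum_i b i * b i != 0];
    last first.
  (* An arbitrary point: Reg(f) is empty in this case. *)
  have A0 : lin 1 0 != 0 by apply: lin0; rewrite oner_eq0.
  by exists (proj_point A0), (proj_point A0); rewrite Reg_isotropic.
have [|s1 [t1 [s2 [t2 [st1 st2 hst]]]]] := @binary_quadratic_zeros C
    (\sum_i a i * a i) (- \sum_i b i * a i) (- 2 * \sum_i b i * b i).
  by rewrite oppr_eq0 mulf_eq0 oppr_eq0 pnatr_eq0.
exists (proj_point (lin0 _ _ st1)), (proj_point (lin0 _ _ st2)) => L RL.
have [v v0 Lv] := proj_spaceP L; have vL : v \in val L by rewrite Lv memv_line.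
have [|s [t [vE q0]]] := plane_section l_lin g_lin delta0 _ (Reg_minor_factor j k RL vL).
  by move=> i; rewrite -trivector_coef_eval; apply: (RL _ (trivector_coef_reg i)).
have pt s' t' (st' : (s' != 0) || (t' != 0)) : s * t' = t * s' -> L = proj_point (lin0 _ _ st').
  move=> /(colinear_pairs st')[c [sE tE]]; apply: (proj_point_eq (c := c) _ v0 Lv).
  by apply/rowP => i; rewrite vE !mxE sE tE mulrDr !mulrA.
by have [/pt ->|/pt ->] := hst s t q0; [left|right].
Qed.

End Independent.

Lemma Reg_two_points : exists P1 P2, Reg f `<=` [set P1; P2].
Proof.
have [ab|nab] := pselect (forall j k, a j * b k = a k * b j).
  by have [P RP] := Reg_dependent ab; exists P, P => L /RP ->; left.
have [j [k jk]] : exists j k, a j * b k - a k * b j != 0.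
  apply: contrapT => njk; apply: nab => j k; apply/eqP; rewrite -subr_eq0.
  by apply: contraT => jk; case: njk; exists j, k.
exact: Reg_independent jk.
Qed.

End RegPoints.

(** * The three parts *)

Lemma proj_dim_le (R : realType) (n : nat) (Z : set (proj_space R n)) m :
  (forall k, has_irr_chain Z k -> (k <= m)%N) -> proj_dim Z <= m%:Z - 1.
Proof.
by move=> hZ; have [k [-> ck _]] := proj_dimP Z; rewrite lerD2r lez_nat hZ.
Qed.

Section MainResults.
Variables (R : realType) (n : nat) (f : {mpoly R[i][n.+1]}).
Hypothesis f_cubic : f \is 3.-homog.

Lemma dim_Reg_le : proj_dim (Reg f) <= proj_dim (Irr f) + 1.
Proof.
have [m [-> _ maxm]] := proj_dimP (Irr f).
have [|gs [sgs gs1 gsI]] := @no_chain_forms _ _ (Irr f) m (Irr_closed f_cubic).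
  by move=> /maxm; rewrite ltnn.
have -> : m%:Z - 1 + 1 = m.+1%:Z - 1 by lia.
apply: proj_dim_le.
by rewrite -sgs => k; apply: chain_Reg.
Qed.

Lemma smooth_Irr : smooth_form f -> Irr f = set0.
Proof.
move=> smf; apply/seteqP; split=> // L IL.
have [v v0 Lv] := proj_spaceP L; have vL : v \in val L by rewrite Lv memv_line.
rewrite IrrE in IL.
have fL : zeros [set f] L.
  apply/(zeros1P v0 vL f_cubic).
  by apply: (homog_eval0 f_cubic) => i; apply: (IL _ (imageT _ i) v vL).
have [i []] := smf L fL.
by move=> _ ->; apply: IL; exists i.
Qed.

Lemma smooth_dim_Reg : smooth_form f -> proj_dim (Reg f) = 0.
Proof.
move=> smf; have I0 := smooth_Irr smf.
have [m [-> chm maxm]] := proj_dimP (Reg f).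
suff -> : m = 1%N by rewrite subrr.
(* As Irr(f) is empty, the empty list of forms has no common zero on it. *)
have m1 : (m <= 1)%N.
  by apply: (chain_Reg (gs := [::]) f_cubic) chm => // L; rewrite I0.
have [w [wE [i wi]]] := eigenvector_exists (cubic_deriv_homog f_cubic).
have v0 : \row_i w i != 0 by apply/rV0Pn; exists i; rewrite mxE.
have RP : Reg f (proj_point v0).
  apply: (eigen_Reg f_cubic); last by rewrite I0.
  by rewrite row_fun_eq.
apply/eqP; rewrite eqn_leq m1; apply: maxm; apply/has_irr_chainP.
exists (fun=> [set proj_point v0]); split=> // [_ _|_ -> //].
by split; [apply: proj_point_closed|apply: proj_point_irr].
Qed.


Lemma Irr_dim_double_hyperplane : proj_dim (Irr f) = n%:Z - 1 ->
  f != 0 /\ exists l g : {mpoly R[i][n.+1]},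
    [/\ l \is 1.-homog, g \is 1.-homog & f = l ^+ 2 * g].
Proof.
have [m [-> chm maxm]] := proj_dimP (Irr f).
move=> /(@addIr _ _ _ _)[mn]; rewrite mn in chm maxm.
(* For f = 0, Irr(f) is all of P^n and has a chain of n + 1 members. *)
suff f0 : f != 0 by split=> //; apply: chain_double_hyperplane.
apply/eqP => f0; have := @setT_chain R n.
rewrite (_ : setT = Irr f) => [/maxm|]; first by rewrite ltnn.
apply/seteqP; split=> // L _; rewrite IrrE => _ [i _ <-] x _.
by rewrite f0 mderiv0 meval0.
Qed.

Lemma Irr_dim_hyperplane : proj_dim (Irr f) = n%:Z - 1 <-> is_hyperplane (Irr f).
Proof.
split=> [/Irr_dim_double_hyperplane[f0 [l [g [l1 g1 fE]]]]|]; last exact: hyperplane_dim.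
exists l; first by split=> //; apply: (l_neq0 f0 fE).
exact: (Irr_double_hyperplane f_cubic f0 l1 g1 fE).
Qed.

Lemma Irr_dim_Reg_points : proj_dim (Irr f) = n%:Z - 1 ->
  exists P1 P2, Reg f `<=` [set P1; P2].
Proof.
move=> /Irr_dim_double_hyperplane[f0 [l [g [l1 g1 fE]]]].
exact: (Reg_two_points f0 l1 g1 fE).
Qed.

(** The irregular ideal is zero, so its first power already multiplies 1 into the eigen ideal: the
    saturation is the unit ideal. *)
Lemma Reg_cubic0 : f = 0 -> Reg f = set0.
Proof.
move=> f0; apply/seteqP; split=> // L RL.
have [v v0 Lv] := proj_spaceP L.
have reg1 : reg_ideal f 1.
  exists 1%N; apply: ideal_span_min.
    have [I0 ID IM] := ideal_span_ideal
      (range (fun g : 'I_2 -> 'I_n.+1 => \det (colsub g (eigen_mx f)))).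
    split=> /= [|p q|a p]; first by rewrite mulr0.
      by rewrite !mul1r; apply: ID.
    by rewrite !mul1r; apply: IM.
  move=> _ [t tJ <-]; rewrite big_ord1 mul1r.
  have -> : t ord0 = 0.
    move: (tJ ord0); apply: (ideal_span_min (I := [set 0])).
      by split=> //= [p q -> ->|a p ->]; rewrite ?addr0 ?mulr0.
    by move=> _ [i _ <-]; rewrite f0 mderiv0.
  by case: (ideal_span_ideal (range (fun g : 'I_2 -> 'I_n.+1 => \det (colsub g (eigen_mx f))))).
have := RL 1 reg1 v; rewrite Lv memv_line meval1 => /(_ isT)/eqP.
by rewrite oner_eq0.
Qed.

Lemma chain_two_points (Z : set (proj_space R n)) P1 P2 k :
  Z `<=` [set P1; P2] -> has_irr_chain Z k -> (k <= 1)%N.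
Proof.
move=> ZP; have [v1 v10 Pv1] := proj_spaceP P1; have [v2 v20 Pv2] := proj_spaceP P2.
have [|l l1 lv] := @generic_linear_form R n 2 (fun i => if i == ord0 then v1 else v2).
  by move=> i; case: ifP.
apply: (chain_le_size (gs := [:: l])) => [g|L /ZP LP].
  by rewrite inE => /eqP ->.
exists l; first exact: mem_head.
move=> lL; case: LP => LE; rewrite LE in lL.
  by have /eqP := lv ord0; apply; apply: (lL l erefl); rewrite Pv1 memv_line.
by have /eqP := lv ord_max; apply; apply: (lL l erefl); rewrite Pv2 memv_line.
Qed.

Lemma dim_Irr_of_Reg : (2 <= n)%N -> proj_dim (Reg f) = n%:Z - 1 ->
  proj_dim (Irr f) = n%:Z - 2.
Proof.
move=> n2 dR; have [r [rE chr _]] := proj_dimP (Reg f).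
have rn : r = n by move: dR; rewrite rE => /addIr[].
have Rle := dim_Reg_le.
have [m [mE chm maxm]] := proj_dimP (Irr f).
have nm : (n <= m.+1)%N by move: Rle; rewrite dR mE; lia.
have [f0|f0] := eqVneq f 0.
  have : has_irr_chain (Reg f) 1.
    by apply: has_irr_chain_leq chr; rewrite rn ltnW.
  rewrite (Reg_cubic0 f0) => /has_irr_chainP[F [Fci F0 _]].
  have [_ [[L FL] _]] := Fci _ (leqnn _).
  by case: (F0 L FL).
have mn : (m <= n)%N.
  have [x fx] := mpoly_neq0_eval f0.
  have x0 : \row_i x i != 0.
    apply: contraNneq fx => /rowP x0; rewrite (meval_eq (v2 := fun j => 0 * x j)).
      by rewrite (meval_scale _ _ f_cubic) expr0n mul0r.
    by move=> j; have := x0 j; rewrite !mxE mul0r.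
  apply: (chain_notin (L := proj_point x0)) chm => /(Irr_point f_cubic x0).
  by rewrite row_fun_eq => /(homog_eval0 f_cubic)/eqP; rewrite (negPf fx).
(* Here m is dim Irr(f) + 1, so m = n is the case of (b): then Reg(f) has at most two points and no
   chain with n >= 2 members. Only m = n - 1 remains. *)
have [mn'|mn'] := eqVneq m n.
  have [|P1 [P2 RP]] := Irr_dim_Reg_points; first by rewrite mE mn'.
  by have := chain_two_points RP chr; rewrite rn leqNgt n2.
by rewrite mE; lia.
Qed.

End MainResults.

Theorem proposition3p3 (R : realType) (n : nat) (f : {mpoly R[i][n.+1]})
    (f_cubic : f \is 3.-homog) :
  (* (a) *)
  (proj_dim (Reg f) <= proj_dim (Irr f) + 1 /\
   (smooth_form f -> proj_dim (Reg f) = 0)) /\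
  (* (b) *)
  ((proj_dim (Irr f) = n%:Z - 1 <-> is_hyperplane (Irr f)) /\
   (proj_dim (Irr f) = n%:Z - 1 ->
      contains_double_hyperplane f /\
      (Reg f #= `I_0 \/ Reg f #= `I_1 \/ Reg f #= `I_2))) /\
  (* (c) *)
  ((2 <= n)%N -> proj_dim (Reg f) = n%:Z - 1 -> proj_dim (Irr f) = n%:Z - 2).
Proof.
split; first by split; [apply: dim_Reg_le|apply: smooth_dim_Reg].
split; last exact: dim_Irr_of_Reg.
split; first exact: Irr_dim_hyperplane.
move=> dI; split; last first.
  by have [P1 [P2 /card_sub_pair]] := Irr_dim_Reg_points f_cubic dI.
have [f0 [l [g [l1 g1 fE]]]] := Irr_dim_double_hyperplane f_cubic dI.
by exists l; [split=> //; apply: (l_neq0 f0 fE) | exists g].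
Qed.
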